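(* Let $(M,g)$ and $(N,h)$ be Riemannian manifolds and let $F:(M,g)\to(N,h)$ be a horizontally conformal submersion with dilation $\lambda$. Then $F$ is totally geodesic if and only if all of the following hold: (i) the fibers of $F$ are totally geodesic; (ii) the horizontal distribution $(\mathrm{Ker}F_\ast)^\perp$ is totally geodesic; (iii) $F$ is horizontally homothetic.
   Context: A horizontally conformal submersion with dilation $\lambda$ is a surjective smooth submersion $F:(M,g)\to(N,h)$ between Riemannian manifolds together with a smooth function $\lambda:M\to\mathbb{R}^+$ such that $h(F_\ast X,F_\ast Y)=\lambda^2(p)\,g(X,Y)$ for all $p\in M$ and all $X,Y\in(\mathrm{Ker}F_{\ast p})^\perp$. The second fundamental form of $F$ is $(\nabla F_\ast)(X,Y)=\nabla^F_XF_\ast Y-F_\ast(\nabla_XY)$ for $X,Y\in\Gamma(TM)$, where $\nabla$ is the Levi-Civita connection of $g$ and $\nabla^F$ is the pullback to $F^{-1}TN$ of the Levi-Civita connection of $h$. $F$ is totally geodesic if $\nabla F_\ast=0$. The vertical distribution is $\mathrm{Ker}F_\ast$ (tangent to the fibers). The fibers are totally geodesic if $\nabla_UV$ is vertical for all vertical vector fields $U,V$; the horizontal distribution is totally geodesic if $\nabla_XY$ is horizontal for all horizontal vector fields $X,Y$. $F$ is horizontally homothetic if the gradient of its dilation is vertical, i.e. $\mathcal{H}(\mathrm{grad}\,\lambda)=0$, with $\mathcal{H}$ the orthogonal projection onto $(\mathrm{Ker}F_\ast)^\perp$. *)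

(* Defs.v *)
From HB Require Import structures.
From mathcomp Require Import all_boot all_order all_algebra.
From mathcomp Require Import all_classical all_reals all_analysis.

Set Implicit Arguments.
Unset Strict Implicit.
Unset Printing Implicit Defensive.

Import Order.TTheory GRing.Theory Num.Theory.
Import numFieldNormedType.Exports.

Local Open Scope classical_set_scope.
Local Open Scope ring_scope.

(* [iter_derive f [:: v1; ...; vk]] is the iterated directional derivative
   D_v1 (... (D_vk f)). *)
Definition iter_derive (R : realType) (V W : normedModType R)
    (f : V -> W) (s : seq V) : V -> W :=
  foldr (fun v (g : V -> W) x => 'D_v g x) f s.

(* f is C^oo on a neighbourhood of x: its iterated directional derivatives of
   every order (including order 0) are Frechet differentiable there. *)
Definition smooth_at (R : realType) (V W : normedModType R)
    (f : V -> W) (x : V) : Prop :=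
  \forall y \near x, forall s : seq V, differentiable (iter_derive f s) y.

(* [chart_map] and [chart_inv] are total functions, but only [chart_map] on
   [chart_dom] and [chart_inv] on [chart_map @` chart_dom] are meaningful. *)
Record chart (R : realType) (n : nat) (T : topologicalType) := Chart {
  chart_dom : set T;
  chart_map : T -> 'rV[R]_n;
  chart_inv : 'rV[R]_n -> T;
  chart_dom_open : open chart_dom;
  chart_img_open : open (chart_map @` chart_dom);
  chart_mapK : forall p, chart_dom p -> chart_inv (chart_map p) = p;
  chart_map_continuous : forall p, chart_dom p -> {for p, continuous chart_map};
  chart_inv_continuous :
    forall p, chart_dom p -> {for chart_map p, continuous chart_inv}
}.

(* Smooth n-manifolds without boundary. The atlas is indexed by the points,
   with a chart around each point singled out; any smooth structure is
   generated by such an atlas, obtained by choosing a chart at every point. *)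
Record manifold (R : realType) (n : nat) := Manifold {
  point_of :> topologicalType;
  manifold_hausdorff : hausdorff_space point_of;
  manifold_second_countable : @second_countable point_of;
  chart_at : point_of -> chart R n point_of;
  mem_chart_at : forall p, chart_dom (chart_at p) p;
  chart_compat : forall p q r,
    chart_dom (chart_at p) r -> chart_dom (chart_at q) r ->
    smooth_at (chart_map (chart_at p) \o chart_inv (chart_at q))
              (chart_map (chart_at q) r)
}.

(* The tangent space T_pM is R^n, a vector being given by its components in
   the chart [chart_at p]. Hence a vector field on M, and more generally a
   section of the pullback bundle F^-1 TN for F : M -> N (W q is an element of
   T_{F q}N), is a function to R^n; since the chart varies with the point,
   smoothness has to be read off after a change of components to a fixed
   chart. [tangent_coord a b v] is the vector of components in the chart
   [chart_at a] of v in T_bN. *)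
Definition tangent_coord (R : realType) (n : nat) (N : manifold R n)
    (a b : N) (v : 'rV[R]_n) : 'rV[R]_n :=
  'd (chart_map (chart_at a) \o chart_inv (chart_at b))
     (chart_map (chart_at b) b) v.

Section Smoothness.
Variables (R : realType) (m n : nat) (M : manifold R m) (N : manifold R n).

Definition smooth_fun_at (W : normedModType R) (f : M -> W) (p : M) : Prop :=
  smooth_at (f \o chart_inv (chart_at p)) (chart_map (chart_at p) p).

(* The differential of a function f at p: [dfun f p v] is v(f), v in T_pM. *)
Definition dfun (f : M -> R) (p : M) (v : 'rV[R]_m) : R :=
  'd (f \o chart_inv (chart_at p)) (chart_map (chart_at p) p) v.

Definition smooth_map (F : M -> N) : Prop :=
  continuous F /\ forall p, smooth_fun_at (chart_map (chart_at (F p)) \o F) p.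

(* The differential F_{*p} : T_pM -> T_{F p}N. *)
Definition dmap (F : M -> N) (p : M) (v : 'rV[R]_m) : 'rV[R]_n :=
  'd (chart_map (chart_at (F p)) \o F \o chart_inv (chart_at p))
     (chart_map (chart_at p) p) v.

(* W is a section of F^-1 TN that is smooth on a neighbourhood of p. *)
Definition smooth_along (F : M -> N) (W : M -> 'rV[R]_n) (p : M) : Prop :=
  smooth_fun_at (fun q => tangent_coord (F p) (F q) (W q)) p.

End Smoothness.

Definition smooth_field_at (R : realType) (m : nat) (M : manifold R m)
    (X : M -> 'rV[R]_m) (p : M) : Prop :=
  smooth_along (@idfun M) X p.

Definition smooth_field (R : realType) (m : nat) (M : manifold R m)
    (X : M -> 'rV[R]_m) : Prop :=
  forall p, smooth_field_at X p.

(* [gram g p] is the matrix of g_p in the components on T_pM. *)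
Definition inner (R : realType) (m : nat) (G : 'M[R]_m) (u v : 'rV[R]_m) : R :=
  (u *m G *m v^T) 0 0.

Record metric (R : realType) (m : nat) (M : manifold R m) := Metric {
  gram : M -> 'M[R]_m;
  gram_sym : forall p u v, inner (gram p) u v = inner (gram p) v u;
  gram_pos : forall p u, u != 0 -> 0 < inner (gram p) u u;
  gram_smooth : forall p X Y, smooth_field_at X p -> smooth_field_at Y p ->
    smooth_fun_at (fun q => inner (gram q) (X q) (Y q) : R) p
}.

Definition mdot (R : realType) (m : nat) (M : manifold R m) (g : metric M)
    (p : M) (u v : 'rV[R]_m) : R := inner (gram g p) u v.

(* grad f = g^{ij} (d_j f) d_i in components. *)
Definition grad (R : realType) (m : nat) (M : manifold R m) (g : metric M)
    (f : M -> R) (p : M) : 'rV[R]_m :=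
  (\row_j dfun f p (delta_mx 0 j)) *m invmx (gram g p).

Lemma gram_unit (R : realType) (m : nat) (M : manifold R m) (g : metric M)
  (p : M) : gram g p \in unitmx.
Proof.
rewrite -row_free_unit -kermx_eq0; apply/rowV0P => u /sub_kermxP ug0.
apply/eqP; apply/negPn/negP => /(gram_pos g p).
by rewrite /inner ug0 mul0mx mxE ltxx.
Qed.

Lemma mdot_grad (R : realType) (m : nat) (M : manifold R m) (g : metric M)
  (f : M -> R) (p : M) (v : 'rV[R]_m) : mdot g p (grad g f p) v = dfun f p v.
Proof.
rewrite /mdot /inner /grad mulmxKV ?gram_unit// mxE.
rewrite {2}(matrix_sum_delta v) big_ord1 /dfun linear_sum.
apply: eq_bigr => j _; rewrite !mxE linearZ /=.
by rewrite mulrC.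
Qed.

(* Covariant derivatives of sections of F^-1 TN: [nabla p v W] is the
   derivative at p, in the direction v in T_pM, of a section W that is smooth
   near p (sections are not required to be smooth far from p, so that Leibniz'
   rule for indicator functions makes nabla local). For F = id these are the
   affine connections on M. *)
Record connection_along (R : realType) (m n : nat)
    (M : manifold R m) (N : manifold R n) (F : M -> N)
    (nabla : M -> 'rV[R]_m -> (M -> 'rV[R]_n) -> 'rV[R]_n) : Prop := {
  conn_linear : forall p W, smooth_along F W p ->
    linear (fun v => nabla p v W);
  conn_add : forall p v W1 W2, smooth_along F W1 p -> smooth_along F W2 p ->
    nabla p v (fun q => W1 q + W2 q) = nabla p v W1 + nabla p v W2;
  conn_leibniz : forall p v (f : M -> R) W,
    smooth_fun_at f p -> smooth_along F W p ->
    nabla p v (fun q => f q *: W q) = dfun f p v *: W p + f p *: nabla p v W;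
  conn_smooth : forall p X W, smooth_field_at X p -> smooth_along F W p ->
    smooth_along F (fun q => nabla q (X q) W) p
}.

(* Torsion-freeness, nabla_X Y - nabla_Y X = [X, Y], is stated by letting both
   sides act on functions, where [X, Y] f = X (Y f) - Y (X f). *)
Record levi_civita (R : realType) (m : nat) (M : manifold R m) (g : metric M)
    (nabla : M -> 'rV[R]_m -> (M -> 'rV[R]_m) -> 'rV[R]_m) : Prop := {
  lc_connection : connection_along (@idfun M) nabla;
  lc_torsion_free : forall p X Y (f : M -> R),
    smooth_field_at X p -> smooth_field_at Y p -> smooth_fun_at f p ->
    dfun f p (nabla p (X p) Y - nabla p (Y p) X) =
    dfun (fun q => dfun f q (Y q)) p (X p)
    - dfun (fun q => dfun f q (X q)) p (Y p);
  lc_metric : forall p v X Y, smooth_field_at X p -> smooth_field_at Y p ->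
    dfun (fun q => mdot g q (X q) (Y q)) p v =
    mdot g p (nabla p v X) (Y p) + mdot g p (X p) (nabla p v Y)
}.

(* The second clause determines nablaF, as sections of F^-1 TN are locally
   combinations of sections Z \o F with smooth coefficients. *)
Definition pullback_connection (R : realType) (m n : nat)
    (M : manifold R m) (N : manifold R n) (F : M -> N)
    (nablaN : N -> 'rV[R]_n -> (N -> 'rV[R]_n) -> 'rV[R]_n)
    (nablaF : M -> 'rV[R]_m -> (M -> 'rV[R]_n) -> 'rV[R]_n) : Prop :=
  connection_along F nablaF /\
  forall p v Z, smooth_field_at Z (F p) ->
    nablaF p v (Z \o F) = nablaN (F p) (dmap F p v) Z.

Section Submersions.
Variables (R : realType) (m n : nat) (M : manifold R m) (N : manifold R n).
Variables (g : metric M) (h : metric N) (F : M -> N).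

Definition vertical (p : M) (u : 'rV[R]_m) : Prop := dmap F p u = 0.

Definition horizontal (p : M) (u : 'rV[R]_m) : Prop :=
  forall v, vertical p v -> mdot g p u v = 0.

Record horizontally_conformal_submersion (lambda : M -> R) : Prop := {
  hcs_smooth : smooth_map F;
  hcs_surjective : forall y, exists x, F x = y;
  hcs_submersion : forall p w, exists v, dmap F p v = w;
  hcs_dilation_smooth : forall p, smooth_fun_at (lambda : M -> R) p;
  hcs_dilation_pos : forall p, 0 < lambda p;
  hcs_conformal : forall p X Y, horizontal p X -> horizontal p Y ->
    mdot h (F p) (dmap F p X) (dmap F p Y) = lambda p ^+ 2 * mdot g p X Y
}.

Definition second_fundamental_form
    (nablaM : M -> 'rV[R]_m -> (M -> 'rV[R]_m) -> 'rV[R]_m)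
    (nablaF : M -> 'rV[R]_m -> (M -> 'rV[R]_n) -> 'rV[R]_n)
    (X Y : M -> 'rV[R]_m) (p : M) : 'rV[R]_n :=
  nablaF p (X p) (fun q => dmap F q (Y q)) - dmap F p (nablaM p (X p) Y).

Definition totally_geodesic_map
    (nablaM : M -> 'rV[R]_m -> (M -> 'rV[R]_m) -> 'rV[R]_m)
    (nablaF : M -> 'rV[R]_m -> (M -> 'rV[R]_n) -> 'rV[R]_n) : Prop :=
  forall X Y, smooth_field X -> smooth_field Y ->
  forall p, second_fundamental_form nablaM nablaF X Y p = 0.

Definition totally_geodesic_fibers
    (nablaM : M -> 'rV[R]_m -> (M -> 'rV[R]_m) -> 'rV[R]_m) : Prop :=
  forall U V, smooth_field U -> smooth_field V ->
  (forall p, vertical p (U p)) -> (forall p, vertical p (V p)) ->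
  forall p, vertical p (nablaM p (U p) V).

Definition totally_geodesic_horizontal_distribution
    (nablaM : M -> 'rV[R]_m -> (M -> 'rV[R]_m) -> 'rV[R]_m) : Prop :=
  forall X Y, smooth_field X -> smooth_field Y ->
  (forall p, horizontal p (X p)) -> (forall p, horizontal p (Y p)) ->
  forall p, horizontal p (nablaM p (X p) Y).

Definition horizontally_homothetic (lambda : M -> R) : Prop :=
  forall p, vertical p (grad g lambda p).

End Submersions.

(* Main.v *)
Require Import Defs.
From HB Require Import structures.
From mathcomp Require Import all_boot all_order all_algebra.
From mathcomp Require Import all_classical all_reals all_analysis.

Set Implicit Arguments.
Unset Strict Implicit.
Unset Printing Implicit Defensive.

Import Order.TTheory GRing.Theory Num.Theory.
Import numFieldNormedType.Exports.

Local Open Scope classical_set_scope.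
Local Open Scope ring_scope.

(** Why the theorem holds. Let [B X Y = nablaF X (F_* Y) - F_* (nablaM X Y)].
    The proof rests on three properties of [B].

    - [B] is symmetric ([sff_sym]): both connections are torsion-free.
    - If [V] is vertical then [F_* V = 0], so [B X V = - F_* (nablaM X V)]
      ([sff_vertical]).
    - For [Y] and [Z] horizontal, differentiating
      [h (F_* Y) (F_* Z) = lambda^2 g Y Z] along [X] gives
      [h (B X Y) (F_* Z) + h (F_* Y) (B X Z) = X(lambda^2) g Y Z]
      ([sff_horizontal]), because both connections are metric.

    Suppose that [B = 0]. The second property makes the fibers totally geodesic
    and makes [nablaM X V] vertical for [V] vertical; as [nablaM] is metric, the
    latter says that [nablaM X Y] is horizontal for [X] and [Y] horizontal. The
    third property gives [X(lambda^2) g Y Z = 0]; choosing for [X], [Y] and [Z]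
    the horizontal part of the gradient of [lambda] makes that part zero.

    Conversely, split both arguments of [B] into horizontal and vertical parts.
    On two vertical fields [B] vanishes because the fibers are totally geodesic.
    On a mixed pair, by symmetry, the vertical field may be taken second, and
    [nablaM X V] is vertical because the horizontal distribution is totally
    geodesic. On horizontal fields [h (B X Y) (F_* Z)] is symmetric in [X] and
    [Y] and, as the gradient of [lambda] is vertical, skew in [Y] and [Z]; such
    a trilinear expression is zero.

    Nondegeneracy of the metrics always has to be tested on globally defined
    smooth horizontal or vertical fields. These are never built with cutoff
    functions: the horizontal lift [W |-> lambda^-2 F^* W] ([horizontal_lift],
    with [F^*] the pointwise adjoint of [F_*]) turns a smooth section along [F]
    into a smooth horizontal field, so that the horizontal part of any smooth
    field, and in particular of [nablaM X Y] or of [grad lambda], is available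
    as a test field.

    The remaining work is local. Smooth functions are closed under the algebraic
    operations, composition and matrix inversion; the differential obeys the
    chain rule across charts; a connection only depends on the germ of the
    section. Expanding a section along [F] in a coordinate frame around [F p]
    ([conn_frame]) then shows that the pullback connection inherits metricity
    ([nablaF_metric]) and torsion-freeness ([nablaF_torsion_free]) from the
    Levi-Civita connections. *)

(** * Differentiability is local *)

Lemma near_eq_diff_locally (R : realType) (V W : normedModType R)
    (f g : V -> W) (x : V) :
  differentiable f x -> (\forall y \near x, f y = g y) ->
  g \o shift x = cst (g x) + 'd f x +o_ 0 id.
Proof.
move=> df fg; apply/eqaddoP => e e0.
have /eqaddoP /(_ e e0) := diff_locally df.
have fgs : \forall h \near 0, f (h + x) = g (h + x).
  by rewrite (near_shift x) /=; near=> y; rewrite /= sub0r subrK; near: y.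
apply: filter_app; near=> h.
have fgh : f (h + x) = g (h + x) by near: h.
by rewrite /= !fctE /= /cst fgh (nbhs_singleton fg).
Unshelve. all: by end_near. Qed.

Lemma near_eq_diff (R : realType) (V W : normedModType R) (f g : V -> W) x :
  differentiable f x -> (\forall y \near x, f y = g y) ->
  'd g x = 'd f x :> (V -> W).
Proof.
move=> df fg; apply: diff_unique; first exact: diff_continuous.
exact: near_eq_diff_locally.
Qed.

Lemma near_eq_differentiable (R : realType) (V W : normedModType R)
    (f g : V -> W) x :
  differentiable f x -> (\forall y \near x, f y = g y) -> differentiable g x.
Proof.
move=> df fg; apply/diff_locallyP; rewrite (near_eq_diff df fg); split.
  exact: diff_continuous.
exact: near_eq_diff_locally.
Qed.

(** Chain rule for a function that only agrees with the composition near the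
    point, as is the case for maps read in charts *)
Lemma near_eq_diff_comp (R : realType) (U V W : normedModType R)
    (f : U -> V) (g : V -> W) (h : U -> W) x y :
  f x = y -> differentiable f x -> differentiable g y ->
  (\forall z \near x, g (f z) = h z) ->
  differentiable h x /\ forall v, 'd h x v = 'd g y ('d f x v).
Proof.
move=> <- df dg gfh; have dgf := differentiable_comp df dg.
split; first exact: near_eq_differentiable dgf gfh.
by move=> v; rewrite (near_eq_diff dgf gfh) diff_comp.
Qed.

Lemma differentiable_rV (R : realType) (V : normedModType R) (n : nat)
    (f : V -> 'rV[R]_n) (x : V) :
  (forall i, differentiable (fun y => f y 0 i : R) x) -> differentiable f x.
Proof.
move=> df.
have -> : f = \sum_(i < n) (fun y => f y 0 i *: delta_mx 0 i).
  apply/funext => y; rewrite fct_sumE.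
  by rewrite {1}(matrix_sum_delta (f y)) big_ord1.
by apply: differentiable_sum => i; apply: differentiableZl.
Qed.

Lemma derive_rV (R : realType) (V : normedModType R) (n : nat)
    (f : V -> 'rV[R]_n) (x v : V) (i : 'I_n) :
  differentiable f x -> 'D_v f x 0 i = 'D_v (fun y => f y 0 i : R) x.
Proof.
by move=> df; rewrite derive_mx ?mxE//; exact: diff_derivable.
Qed.

Lemma differentiable_entry (R : realType) (V : normedModType R) (n : nat)
    (f : V -> 'rV[R]_n) (x : V) (i : 'I_n) :
  differentiable f x -> differentiable (fun y => f y 0 i : R) x.
Proof.
move=> df.
apply: (@differentiable_comp _ _ _ _ f (fun y : 'rV[R]_n => y 0 i : R)) => //.
exact: differentiable_coord.
Qed.

(** * Functions of class C^k *)

Section Ck.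
Context {R : realType} {V : normedModType R}.

(** Smoothness is [Ck] for all [k] on one open set. The closure properties below
    go by induction on [k]: the Leibniz and chain rules express a derivative of
    the result through functions that are known to be of class C^k. The open set
    is kept fixed during the induction, since a neighbourhood that shrinks with
    [k] would not give smoothness in the limit. *)
Definition Ck {W : normedModType R} (f : V -> W) (U : set V) (k : nat) : Prop :=
  forall s : seq V, (size s <= k)%N ->
  forall x, U x -> differentiable (iter_derive f s) x.

(** Induction on the order has to peel off the innermost derivative, which is the
    last entry of the list. *)
Lemma CkS {W : normedModType R} (f : V -> W) U k :
  Ck f U k.+1 <->
  (forall x, U x -> differentiable f x) /\ forall v, Ck ('D_v f) U k.
Proof.
split=> [fk|[df fk] s].
  split=> [|v s sk]; first exact: (fk [::]).
  by have := fk (rcons s v); rewrite size_rcons /iter_derive foldr_rcons; apply.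
case/lastP: s => [_|s v]; first exact: df.
by rewrite size_rcons /iter_derive foldr_rcons => sk; exact: fk.
Qed.

Lemma Ck0 {W : normedModType R} (f : V -> W) U :
  Ck f U 0 <-> forall x, U x -> differentiable f x.
Proof.
split=> [fk|df s]; first exact: (fk [::]).
by rewrite leqn0 size_eq0 => /eqP ->.
Qed.

Lemma Ck_differentiable {W : normedModType R} (f : V -> W) U k :
  Ck f U k -> forall x, U x -> differentiable f x.
Proof. by move=> fk; exact: (fk [::]). Qed.

Lemma CkW {W : normedModType R} (f : V -> W) U k : Ck f U k.+1 -> Ck f U k.
Proof. by move=> fk s sk; apply: fk; exact: leqW. Qed.

Lemma eq_Ck {W : normedModType R} (f g : V -> W) U k : Ck f U k -> open U ->
  (forall x, U x -> f x = g x) -> Ck g U k.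
Proof.
move=> fk oU; elim: k f g fk => [|k IH] f g fk fg.
  move: fk => /Ck0 df; apply/Ck0 => x Ux.
  apply: near_eq_differentiable (df x Ux) _.
  by apply: filterS (open_nbhs_nbhs (conj oU Ux)) => y; exact: fg.
move: fk => /CkS[df Df]; apply/CkS; split=> [x Ux|v].
  apply: near_eq_differentiable (df x Ux) _.
  by apply: filterS (open_nbhs_nbhs (conj oU Ux)) => y; exact: fg.
apply: IH (Df v) _ => x Ux; apply: near_eq_derive.
by apply: filterS (open_nbhs_nbhs (conj oU Ux)) => y; exact: fg.
Qed.

Lemma sub_Ck {W : normedModType R} (f : V -> W) U U' k :
  U' `<=` U -> Ck f U k -> Ck f U' k.
Proof. by move=> UU fk s sk x /UU; exact: fk. Qed.

Lemma Ck_cst {W : normedModType R} (a : W) U k : Ck (cst a : V -> W) U k.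
Proof.
elim: k a => [|k IH] a; first by apply/Ck0 => x _; exact: differentiable_cst.
apply/CkS; split=> [x _|v]; first exact: differentiable_cst.
rewrite (_ : 'D_v (cst a) = cst 0); first exact: IH.
by apply/funext => x; rewrite derive_cst.
Qed.

Lemma CkD {W : normedModType R} (f g : V -> W) U k : open U ->
  Ck f U k -> Ck g U k -> Ck (fun x => f x + g x) U k.
Proof.
move=> oU; elim: k f g => [|k IH] f g.
  move=> /Ck0 df /Ck0 dg; apply/Ck0 => x Ux.
  by apply: differentiableD; [exact: df|exact: dg].
move=> /CkS[df Df] /CkS[dg Dg]; apply/CkS; split=> [x Ux|v].
  by apply: differentiableD; [exact: df|exact: dg].
apply: eq_Ck (IH _ _ (Df v) (Dg v)) oU _ => x Ux.
by rewrite deriveD//; apply: diff_derivable; [exact: df|exact: dg].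
Qed.

Lemma CkM (f g : V -> R) U k : open U ->
  Ck f U k -> Ck g U k -> Ck (fun x => f x * g x) U k.
Proof.
move=> oU; elim: k f g => [|k IH] f g.
  move=> /Ck0 df /Ck0 dg; apply/Ck0 => x Ux.
  by apply: differentiableM; [exact: df|exact: dg].
move=> fk gk; have /CkS[df Df] := fk; have /CkS[dg Dg] := gk.
apply/CkS; split=> [x Ux|v].
  by apply: differentiableM; [exact: df|exact: dg].
apply: eq_Ck (CkD oU (IH _ _ (CkW fk) (Dg v)) (IH _ _ (CkW gk) (Df v))) oU _.
move=> x Ux.
by rewrite deriveM//; apply: diff_derivable; [exact: df|exact: dg].
Qed.

Lemma CkV (f : V -> R) U k : open U -> (forall x, U x -> f x != 0) ->
  Ck f U k -> Ck (fun x => (f x)^-1) U k.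
Proof.
move=> oU f0; elim: k f f0 => [|k IH] f f0.
  move=> /Ck0 df; apply/Ck0 => x Ux.
  by apply: differentiableV; [exact: df|exact: f0].
move=> fk; have /CkS[df Df] := fk; apply/CkS; split=> [x Ux|v].
  by apply: differentiableV; [exact: df|exact: f0].
have fV := IH _ f0 (CkW fk).
have N1 : Ck (cst (-1) : V -> R) U k by exact: Ck_cst.
have Dk := CkM oU (CkM oU N1 (CkM oU fV fV)) (Df v).
apply: eq_Ck Dk oU _.
move=> x Ux /=; rewrite deriveV; [|exact: f0|exact/diff_derivable/df].
by rewrite mulN1r -expr2 exprVn.
Qed.

Lemma Ck_sum {W : normedModType R} (I : Type) (r : seq I) (P : pred I)
    (f : I -> V -> W) U k : open U ->
  (forall i, P i -> Ck (f i) U k) -> Ck (fun x => \sum_(i <- r | P i) f i x) U k.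
Proof.
move=> oU fk.
rewrite (_ : (fun x => _) = \big[(fun f g x => f x + g x)/cst 0]_(i <- r | P i) f i).
  by elim/big_ind : _ => //; [exact: Ck_cst|move=> *; exact: CkD].
by apply/funext => x; elim/big_rec2 : _ => //= i a b _ ->.
Qed.

Lemma Ck_rV (n : nat) (f : V -> 'rV[R]_n) U k : open U ->
  (forall i, Ck (fun x => f x 0 i : R) U k) -> Ck f U k.
Proof.
move=> oU; elim: k f => [|k IH] f fk.
  apply/Ck0 => x Ux; apply: differentiable_rV => i.
  exact: (Ck_differentiable (fk i)).
have df x : U x -> differentiable f x.
  by move=> Ux; apply: differentiable_rV => i; exact: (Ck_differentiable (fk i)).
apply/CkS; split=> // v; apply: IH => i.
have /CkS[_ /(_ v) Di] := fk i; apply: eq_Ck Di oU _ => x Ux.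
by rewrite derive_rV//; exact: df.
Qed.

Lemma Ck_entry (n : nat) (f : V -> 'rV[R]_n) U k i : open U ->
  Ck f U k -> Ck (fun x => f x 0 i : R) U k.
Proof.
move=> oU; elim: k f => [|k IH] f.
  by move=> /Ck0 df; apply/Ck0 => x Ux; apply/differentiable_entry/df.
move=> /CkS[df Df]; apply/CkS; split=> [x Ux|v].
  exact/differentiable_entry/df.
by apply: eq_Ck (IH _ (Df v)) oU _ => x Ux; rewrite derive_rV//; exact: df.
Qed.

End Ck.

Lemma diff_rV_sum (R : realType) (n : nat) (W : normedModType R)
    (f : 'rV[R]_n -> W) (x v : 'rV[R]_n) :
  differentiable f x -> 'd f x v = \sum_i v 0 i *: 'D_(delta_mx 0 i) f x.
Proof.
move=> df; rewrite {1}(matrix_sum_delta v) big_ord1 linear_sum.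
by apply: eq_bigr => i _; rewrite linearZ /= deriveE.
Qed.

Lemma Ck_comp (R : realType) (V : normedModType R) (n : nat)
    (f : V -> 'rV[R]_n) (g : 'rV[R]_n -> R) U U' k : open U ->
  (forall x, U x -> U' (f x)) ->
  Ck f U k -> Ck g U' k -> Ck (g \o f) U k.
Proof.
move=> oU UU'; elim: k g => [|k IH] g.
  move=> /Ck0 df /Ck0 dg; apply/Ck0 => x Ux.
  by apply: differentiable_comp; [exact: df|exact/dg/UU'].
move=> fk; have /CkS[df Df] := fk; move=> /CkS[dg Dg].
apply/CkS; split=> [x Ux|v].
  by apply: differentiable_comp; [exact: df|exact/dg/UU'].
have Ds := @Ck_sum _ _ _ _ (index_enum 'I_n) predT
  (fun i x => 'D_v f x 0 i * ('D_(delta_mx 0 i) g \o f) x) U k oU.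
have {}Ds := Ds (fun i _ => CkM oU (Ck_entry i oU (Df v)) (IH _ (CkW fk) (Dg _))).
apply: eq_Ck Ds oU _ => x Ux.
have dfx := df x Ux; have dgx := dg _ (UU' x Ux).
rewrite [RHS]deriveE; last exact: differentiable_comp.
by rewrite diff_comp//= diff_rV_sum// -deriveE.
Qed.

(** * Smooth functions *)

Section SmoothAt.
Context {R : realType} {V : normedModType R}.

Lemma smooth_atP {W : normedModType R} (f : V -> W) x :
  smooth_at f x <-> exists U, [/\ open U, U x & forall k, Ck f U k].
Proof.
split=> [|[U [oU Ux fU]]].
  rewrite /smooth_at -nbhs_nearE nbhsE => -[U [oU Ux] fU].
  by exists U; split=> // k s _ y Uy; exact: fU.
apply: filterS (open_nbhs_nbhs (conj oU Ux)) => y Uy s.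
exact: (fU (size s)).
Qed.

Lemma near_eq_smooth_at {W : normedModType R} (f g : V -> W) x :
  (\forall y \near x, f y = g y) -> smooth_at f x -> smooth_at g x.
Proof.
rewrite -nbhs_nearE nbhsE => -[U' [oU' Ux'] fg] /smooth_atP[U [oU Ux fU]].
apply/smooth_atP; exists (U `&` U'); split=> [||k]; first exact: openI.
  by split.
apply: (@eq_Ck _ _ _ f _ _ _ _ (openI oU oU')); last by move=> y [_ /fg].
by apply: sub_Ck (fU k) => y [].
Qed.

Lemma smooth_at_cst {W : normedModType R} (a : W) (x : V) :
  smooth_at (cst a) x.
Proof.
by apply/smooth_atP; exists setT; split=> // [|k]; [exact: openT|exact: Ck_cst].
Qed.

Lemma smooth_at2 {W1 W2 W3 : normedModType R} (f : V -> W1) (g : V -> W2)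
    (h : V -> W3) x :
  (forall U k, open U -> Ck f U k -> Ck g U k -> Ck h U k) ->
  smooth_at f x -> smooth_at g x -> smooth_at h x.
Proof.
move=> fgh /smooth_atP[U [oU Ux fU]] /smooth_atP[U' [oU' Ux' gU]].
apply/smooth_atP; exists (U `&` U'); split=> [||k]; first exact: openI.
  by split.
apply: fgh; first exact: openI.
  by apply: sub_Ck (fU k) => y [].
by apply: sub_Ck (gU k) => y [].
Qed.

Lemma smooth_atD {W : normedModType R} (f g : V -> W) x :
  smooth_at f x -> smooth_at g x -> smooth_at (fun y => f y + g y) x.
Proof. by apply: smooth_at2 => U k; exact: CkD. Qed.

Lemma smooth_atM (f g : V -> R) x :
  smooth_at f x -> smooth_at g x -> smooth_at (fun y => f y * g y) x.
Proof. by apply: smooth_at2 => U k; exact: CkM. Qed.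

Lemma smooth_at_differentiable {W : normedModType R} (f : V -> W) x :
  smooth_at f x -> differentiable f x.
Proof. by move=> /nbhs_singleton /(_ [::]). Qed.

Lemma near_smooth_at_differentiable {W : normedModType R} (f : V -> W) x :
  smooth_at f x -> \forall y \near x, differentiable f y.
Proof. by apply: filterS => y /(_ [::]). Qed.

Lemma smooth_at_continuous {W : normedModType R} (f : V -> W) x :
  smooth_at f x -> {for x, continuous f}.
Proof. by move=> /smooth_at_differentiable /differentiable_continuous. Qed.

Lemma smooth_atV (f : V -> R) x : f x != 0 ->
  smooth_at f x -> smooth_at (fun y => (f y)^-1) x.
Proof.
move=> fx0 sf; have /smooth_atP[U [oU Ux fU]] := sf.
have : \forall y \near x, f y != 0.
  exact: cvgr_neq0 (smooth_at_continuous sf) fx0.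
rewrite -nbhs_nearE nbhsE => -[U' [oU' Ux'] f0].
apply/smooth_atP; exists (U `&` U'); split=> [||k]; first exact: openI.
  by split.
apply: CkV; [exact: openI|by move=> y [_ /f0]|].
by apply: sub_Ck (fU k) => y [].
Qed.

Lemma smooth_at_derive {W : normedModType R} (f : V -> W) x v :
  smooth_at f x -> smooth_at ('D_v f) x.
Proof.
move=> /smooth_atP[U [oU Ux fU]]; apply/smooth_atP; exists U; split=> // k.
by have /CkS[_] := fU k.+1.
Qed.

Lemma smooth_at_rVP (n : nat) (f : V -> 'rV[R]_n) x :
  smooth_at f x <-> forall i, smooth_at (fun y => f y 0 i : R) x.
Proof.
split=> [/smooth_atP[U [oU Ux fU]] i|fx].
  by apply/smooth_atP; exists U; split=> // k; exact: Ck_entry.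
have /choice[U fU] : forall i, exists U : set V,
    [/\ open U, U x & forall k, Ck (fun y => f y 0 i : R) U k].
  by move=> i; exact/smooth_atP.
have : \forall y \near x, forall i, U i y.
  by apply: filter_forall => i; have [oU Ux _] := fU i; exact: open_nbhs_nbhs.
rewrite -nbhs_nearE nbhsE => -[U' [oU' Ux'] U'U].
apply/smooth_atP; exists U'; split=> // k; apply: Ck_rV => // i.
by have [_ _ /(_ k)] := fU i; apply: sub_Ck => y /U'U.
Qed.

End SmoothAt.

Lemma smooth_at_comp (R : realType) (V : normedModType R) (n : nat)
    (f : V -> 'rV[R]_n) (g : 'rV[R]_n -> R) x :
  smooth_at f x -> smooth_at g (f x) -> smooth_at (g \o f) x.
Proof.
move=> sf /smooth_atP[U' [oU' Ux' gU']].
have fc := smooth_at_continuous sf.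
have /smooth_atP[U [oU Ux fU]] := sf.
have : \forall y \near x, U' (f y) by apply: fc; exact: open_nbhs_nbhs.
rewrite -nbhs_nearE nbhsE => -[U2 [oU2 U2x] fU2].
apply/smooth_atP; exists (U `&` U2); split=> [||k]; first exact: openI.
  by split.
apply: (@Ck_comp _ _ _ _ _ _ U'); first exact: openI.
- by move=> y [_ /fU2].
- by apply: sub_Ck (fU k) => y [].
- exact: gU'.
Qed.

Lemma smooth_at_sum (R : realType) (V W : normedModType R) (I : finType)
    (f : I -> V -> W) (x : V) :
  (forall i, smooth_at (f i) x) -> smooth_at (fun y => \sum_i f i y) x.
Proof.
move=> fx; rewrite (_ : (fun y => _) =
    \big[(fun f g y => f y + g y)/cst 0]_i f i).
  elim/big_ind : _ => //; first exact: smooth_at_cst.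
  by move=> *; exact: smooth_atD.
by apply/funext => y; elim/big_rec2 : _ => //= i a b _ ->.
Qed.

Lemma smooth_at_diff_fun (R : realType) (n : nat) (f : 'rV[R]_n -> R)
    (w : 'rV[R]_n -> 'rV[R]_n) x :
  smooth_at f x -> smooth_at w x -> smooth_at (fun y => 'd f y (w y)) x.
Proof.
move=> sf /smooth_at_rVP sw.
apply: (@near_eq_smooth_at _ _ _
  (fun y => \sum_i w y 0 i * 'D_(delta_mx 0 i) f y)).
  near=> y; rewrite diff_rV_sum//.
  by near: y; exact: near_smooth_at_differentiable sf.
apply: smooth_at_sum => i; apply: smooth_atM => //; exact: smooth_at_derive.
Unshelve. all: by end_near. Qed.

Lemma smooth_at_diff (R : realType) (m n : nat) (f : 'rV[R]_m -> 'rV[R]_n)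
    (w : 'rV[R]_m -> 'rV[R]_m) x :
  smooth_at f x -> smooth_at w x -> smooth_at (fun y => 'd f y (w y)) x.
Proof.
move=> sf sw; apply/smooth_at_rVP => i.
have sfi : smooth_at (fun y => f y 0 i : R) x by move/smooth_at_rVP : sf.
apply: (@near_eq_smooth_at _ _ _ (fun y => 'd (fun z => f z 0 i : R) y (w y))).
  near=> y; have df : differentiable f y.
    by near: y; exact: near_smooth_at_differentiable sf.
  rewrite -!deriveE//; last exact: differentiable_entry.
  by rewrite derive_rV.
exact: smooth_at_diff_fun.
Unshelve. all: by end_near. Qed.

(** * Charts *)

Section Charts.
Context {R : realType} {n : nat} {T : topologicalType} (c : chart R n T).
Implicit Types p : T.

Lemma near_chart_dom p : chart_dom c p -> \forall q \near p, chart_dom c q.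
Proof. by move=> cp; apply: open_nbhs_nbhs; split=> //; exact: chart_dom_open. Qed.

Lemma near_chart_inv (P : set T) p : chart_dom c p ->
  (\forall q \near p, P q) -> \forall x \near chart_map c p, P (chart_inv c x).
Proof.
move=> cp Pp; have := chart_inv_continuous cp; apply.
by rewrite chart_mapK.
Qed.

Lemma near_chart_map (P : set 'rV[R]_n) p : chart_dom c p ->
  (\forall x \near chart_map c p, P x) -> \forall q \near p, P (chart_map c q).
Proof. by move=> cp Pp; exact: chart_map_continuous cp _ Pp. Qed.

Lemma near_chart_invK p : chart_dom c p ->
  \forall x \near chart_map c p, chart_map c (chart_inv c x) = x.
Proof.
move=> cp; have : \forall x \near chart_map c p, (chart_map c @` chart_dom c) x.
  by apply: open_nbhs_nbhs; split; [exact: chart_img_open|exists p].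
by apply: filterS => x [q cq <-]; rewrite chart_mapK.
Qed.

End Charts.

(** * The differential and its chain rules *)

Section Differential.
Context {R : realType} {n : nat} {N : manifold R n}.
Implicit Types a b p q : N.

Definition differentiable_fun_at {W : normedModType R} (f : N -> W) p : Prop :=
  differentiable (f \o chart_inv (chart_at p)) (chart_map (chart_at p) p).

(** The differential of a vector-valued function; [dfun], [tangent_coord] and
    [dmap] are all instances of it, which is why their chain rules are proved
    only once. *)
Definition dvec {W : normedModType R} (f : N -> W) p (v : 'rV[R]_n) : W :=
  'd (f \o chart_inv (chart_at p)) (chart_map (chart_at p) p) v.

(** The inverse of [tangent_coord a q], for [q] in the domain of the chart around
    [a]. With [w] a basis vector and [q] varying it is a coordinate vector field
    of that chart. *)
Definition frame a q (w : 'rV[R]_n) : 'rV[R]_n :=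
  'd (chart_map (chart_at q) \o chart_inv (chart_at a))
     (chart_map (chart_at a) q) w.

Lemma chart_change_differentiable a b q :
  chart_dom (chart_at a) q -> chart_dom (chart_at b) q ->
  differentiable (chart_map (chart_at a) \o chart_inv (chart_at b))
                 (chart_map (chart_at b) q).
Proof. by move=> aq bq; exact/smooth_at_differentiable/chart_compat. Qed.

Lemma chart_change_id a q : chart_dom (chart_at a) q ->
  'd (chart_map (chart_at a) \o chart_inv (chart_at a))
     (chart_map (chart_at a) q) = id :> ('rV[R]_n -> 'rV[R]_n).
Proof.
move=> aq; rewrite (@near_eq_diff _ _ _ id) ?diff_val//.
by apply: filterS (near_chart_invK aq) => x /= ->.
Qed.

Lemma diff_chart_change {W : normedModType R} (f : N -> W) a b q :
  chart_dom (chart_at a) q -> chart_dom (chart_at b) q ->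
  differentiable (f \o chart_inv (chart_at a)) (chart_map (chart_at a) q) ->
  differentiable (f \o chart_inv (chart_at b)) (chart_map (chart_at b) q) /\
  forall v, 'd (f \o chart_inv (chart_at b)) (chart_map (chart_at b) q) v =
  'd (f \o chart_inv (chart_at a)) (chart_map (chart_at a) q)
    ('d (chart_map (chart_at a) \o chart_inv (chart_at b))
        (chart_map (chart_at b) q) v).
Proof.
move=> aq bq df; have dc := chart_change_differentiable aq bq.
apply: near_eq_diff_comp => //; first by rewrite /= chart_mapK.
near=> x; rewrite /= chart_mapK//; near: x.
exact/near_chart_inv/near_chart_dom.
Unshelve. all: by end_near. Qed.

Lemma dvec_chart {W : normedModType R} (f : N -> W) a q v :
  chart_dom (chart_at a) q ->
  differentiable (f \o chart_inv (chart_at a)) (chart_map (chart_at a) q) ->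
  dvec f q v = 'd (f \o chart_inv (chart_at a)) (chart_map (chart_at a) q)
                 (tangent_coord a q v).
Proof.
by move=> aq df; apply: (diff_chart_change _ _ df).2 => //; exact: mem_chart_at.
Qed.

Lemma frameK a q w : chart_dom (chart_at a) q ->
  tangent_coord a q (frame a q w) = w.
Proof.
move=> aq; have qq := mem_chart_at q.
rewrite -[RHS](congr1 (@^~ w) (chart_change_id aq)) /=.
by apply/esym/(@diff_chart_change _ _ q a q _ _ _).2 => //;
  exact: chart_change_differentiable.
Qed.

Lemma tangent_coordK a q v : chart_dom (chart_at a) q ->
  frame a q (tangent_coord a q v) = v.
Proof.
move=> aq; have qq := mem_chart_at q.
rewrite -[RHS](congr1 (@^~ v) (chart_change_id qq)) /=.
by apply/esym/(@diff_chart_change _ _ a q q _ _ _).2 => //;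
  exact: chart_change_differentiable.
Qed.

Lemma tangent_coord_self a v : tangent_coord a a v = v.
Proof. by rewrite /tangent_coord chart_change_id//; exact: mem_chart_at. Qed.

Lemma frame_self a w : frame a a w = w.
Proof. by rewrite /frame chart_change_id//; exact: mem_chart_at. Qed.

Lemma frame_sum a q (w : 'rV[R]_n) :
  frame a q w = \sum_i w 0 i *: frame a q (delta_mx 0 i).
Proof.
rewrite {1}(matrix_sum_delta w) big_ord1 /frame linear_sum.
by apply: eq_bigr => i _; rewrite linearZ.
Qed.

Lemma smooth_fun_at_differentiable {W : normedModType R} (f : N -> W) p :
  smooth_fun_at f p -> differentiable_fun_at f p.
Proof. exact: smooth_at_differentiable. Qed.

Lemma near_smooth_fun_at_differentiable {W : normedModType R} (f : N -> W) p :
  smooth_fun_at f p -> \forall q \near p,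
  differentiable (f \o chart_inv (chart_at p)) (chart_map (chart_at p) q).
Proof.
move=> sf.
exact: (near_chart_map (mem_chart_at p) (near_smooth_at_differentiable sf)).
Qed.

End Differential.

Section SmoothFun.
Context {R : realType} {n : nat} {N : manifold R n}.
Implicit Types p q : N.

Lemma near_eq_coord {W : Type} (f g : N -> W) p :
  (\forall q \near p, f q = g q) ->
  \forall x \near chart_map (chart_at p) p,
    (f \o chart_inv (chart_at p)) x = (g \o chart_inv (chart_at p)) x.
Proof. by move=> fg; exact: near_chart_inv (mem_chart_at p) fg. Qed.

Lemma near_eq_smooth_fun_at {W : normedModType R} (f g : N -> W) p :
  (\forall q \near p, f q = g q) -> smooth_fun_at f p -> smooth_fun_at g p.
Proof. by move=> fg; apply: near_eq_smooth_at; exact: near_eq_coord. Qed.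

Lemma near_eq_dvec {W : normedModType R} (f g : N -> W) p v :
  differentiable_fun_at f p -> (\forall q \near p, f q = g q) ->
  dvec g p v = dvec f p v.
Proof.
by move=> df fg; rewrite /dvec (near_eq_diff df)//; exact: near_eq_coord.
Qed.

Lemma smooth_fun_at_cst {W : normedModType R} (a : W) p :
  smooth_fun_at (fun=> a) p.
Proof. exact: smooth_at_cst. Qed.

Lemma smooth_fun_atD {W : normedModType R} (f g : N -> W) p :
  smooth_fun_at f p -> smooth_fun_at g p ->
  smooth_fun_at (fun q => f q + g q) p.
Proof. exact: smooth_atD. Qed.

Lemma smooth_fun_atM (f g : N -> R) p :
  smooth_fun_at f p -> smooth_fun_at g p ->
  smooth_fun_at (fun q => f q * g q) p.
Proof. exact: smooth_atM. Qed.

Lemma smooth_fun_atV (f : N -> R) p : f p != 0 ->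
  smooth_fun_at f p -> smooth_fun_at (fun q => (f q)^-1) p.
Proof.
by move=> fp0; apply: smooth_atV; rewrite /= chart_mapK//; exact: mem_chart_at.
Qed.

Lemma smooth_fun_at_sum {W : normedModType R} (I : finType) (f : I -> N -> W) p :
  (forall i, smooth_fun_at (f i) p) -> smooth_fun_at (fun q => \sum_i f i q) p.
Proof. exact: smooth_at_sum. Qed.

Lemma smooth_fun_at_prod (I : finType) (f : I -> N -> R) p :
  (forall i, smooth_fun_at (f i) p) -> smooth_fun_at (fun q => \prod_i f i q) p.
Proof.
move=> fp; rewrite (_ : (fun q => _) =
    \big[(fun f g q => f q * g q)/cst 1]_i f i).
  elim/big_ind : _ => //; first exact: smooth_fun_at_cst.
  by move=> *; exact: smooth_fun_atM.
by apply/funext => y; elim/big_rec2 : _ => //= i a b _ ->.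
Qed.

Lemma smooth_fun_at_rVP (k : nat) (f : N -> 'rV[R]_k) p :
  smooth_fun_at f p <-> forall i, smooth_fun_at (fun q => f q 0 i : R) p.
Proof. exact: smooth_at_rVP. Qed.

Lemma dfunM (f g : N -> R) p v :
  differentiable_fun_at f p -> differentiable_fun_at g p ->
  dfun (fun q => f q * g q) p v = f p * dfun g p v + g p * dfun f p v.
Proof.
move=> df dg; rewrite /dfun.
rewrite (_ : _ \o _ =
  (f \o chart_inv (chart_at p)) * (g \o chart_inv (chart_at p)))//.
rewrite diffM//= /GRing.add /= /GRing.scale/= !chart_mapK//; exact: mem_chart_at.
Qed.

Lemma dfunD (f g : N -> R) p v :
  differentiable_fun_at f p -> differentiable_fun_at g p ->
  dfun (fun q => f q + g q) p v = dfun f p v + dfun g p v.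
Proof.
move=> df dg; rewrite /dfun.
rewrite (_ : _ \o _ =
  (f \o chart_inv (chart_at p)) + (g \o chart_inv (chart_at p)))//.
by rewrite diffD.
Qed.

Lemma dfun_cst (a : R) p v : dfun (fun _ : N => a) p v = 0.
Proof. by rewrite /dfun (_ : _ \o _ = cst a)// diff_cst. Qed.

End SmoothFun.

Lemma dfun_sum (R : realType) (n : nat) (N : manifold R n) (I : finType)
    (f : I -> N -> R) (p : N) v :
  (forall i, smooth_fun_at (f i) p) ->
  dfun (fun q => \sum_i f i q) p v = \sum_i dfun (f i) p v.
Proof.
move=> sf; rewrite (_ : (fun q => _) =
    \big[(fun f g q => f q + g q)/fun=> 0]_i f i); last first.
  by apply/funext => y; elim/big_rec2 : _ => //= i a b _ ->.
suff [] : smooth_fun_at (\big[(fun f g q => f q + g q)/fun=> 0]_i f i) p /\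
  dfun (\big[(fun f g q => f q + g q)/fun=> 0]_i f i) p v =
  \sum_i dfun (f i) p v by [].
elim/big_rec2 : _ => [|i a b _ [sb <-]].
  by split; [exact: smooth_fun_at_cst|rewrite dfun_cst].
split; first exact: smooth_fun_atD.
by rewrite dfunD//; exact: smooth_fun_at_differentiable.
Qed.

Section SmoothMap.
Context {R : realType} {m n : nat} {M : manifold R m} {N : manifold R n}.
Variable F : M -> N.
Hypothesis smF : smooth_map F.
Implicit Types p q : M.

Lemma near_map p (P : set N) :
  (\forall y \near F p, P y) -> \forall q \near p, P (F q).
Proof. by move=> Pp; have [cF _] := smF; exact: (cF p). Qed.

Lemma near_coord_comp {W : Type} (f : N -> W) p :
  \forall x \near chart_map (chart_at p) p,
    (f \o chart_inv (chart_at (F p)))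
      ((chart_map (chart_at (F p)) \o F \o chart_inv (chart_at p)) x) =
    ((f \o F) \o chart_inv (chart_at p)) x.
Proof.
near=> x; rewrite /= chart_mapK//; near: x.
exact: (near_chart_inv (mem_chart_at p)
          (near_map (near_chart_dom (mem_chart_at (F p))))).
Unshelve. all: by end_near. Qed.

Lemma smooth_fun_at_comp (f : N -> R) p :
  smooth_fun_at f (F p) -> smooth_fun_at (f \o F) p.
Proof.
move=> sf; apply: near_eq_smooth_at (near_coord_comp f p) _.
apply: smooth_at_comp; first by have [_ /(_ p)] := smF.
by rewrite /= chart_mapK//; exact: mem_chart_at.
Qed.

Lemma dvec_comp {W : normedModType R} (f : N -> W) p :
  differentiable_fun_at f (F p) -> differentiable_fun_at (f \o F) p /\
  forall v, dvec (f \o F) p v = dvec f (F p) (dmap F p v).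
Proof.
move=> df; apply: near_eq_diff_comp df (near_coord_comp f p).
  by rewrite /= chart_mapK//; exact: mem_chart_at.
by have [_ /(_ p)] := smF; exact: smooth_at_differentiable.
Qed.

(** The charts in which [dmap F q] is expressed change with [q]; here they are
    replaced by the two fixed charts around [p] and [F p], which is the form in
    which smoothness in [q] can be seen. *)
Lemma near_tangent_coord_dmap p : \forall q \near p, forall v,
  tangent_coord (F p) (F q) (dmap F q v) =
  'd ((chart_map (chart_at (F p)) \o F) \o chart_inv (chart_at p))
     (chart_map (chart_at p) q) (tangent_coord p q v).
Proof.
have [_ /(_ p) sF] := smF; near=> q => v.
have Fq : chart_dom (chart_at (F p)) (F q).
  by near: q; exact: (near_map (near_chart_dom (mem_chart_at (F p)))).
rewrite -[LHS](dvec_comp _).2; last first.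
  by apply: chart_change_differentiable => //; exact: mem_chart_at.
rewrite (@dvec_chart _ _ _ _ _ p)//; near: q.
  by apply: near_chart_dom; exact: mem_chart_at.
exact: near_smooth_fun_at_differentiable.
Unshelve. all: by end_near. Qed.

Lemma smooth_along_dmap Y p :
  smooth_field_at Y p -> smooth_along F (fun q => dmap F q (Y q)) p.
Proof.
move=> sY; have [_ /(_ p) sF] := smF.
apply: (@near_eq_smooth_fun_at _ _ _ _ (fun q =>
  'd ((chart_map (chart_at (F p)) \o F) \o chart_inv (chart_at p))
     (chart_map (chart_at p) q) (tangent_coord p q (Y q)))).
  by near=> q; apply/esym; near: q;
    apply: filterS (near_tangent_coord_dmap p) => q.
have := smooth_at_diff sF sY; apply: near_eq_smooth_at.
by apply: filterS (near_chart_invK (mem_chart_at p)) => x /= ->.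
Unshelve. all: by end_near. Qed.

Lemma smooth_fun_at_dfun (f : M -> R) Y p :
  smooth_fun_at f p -> smooth_field_at Y p ->
  smooth_fun_at (fun q => dfun f q (Y q)) p.
Proof.
move=> sf sY; apply: (@near_eq_smooth_fun_at _ _ _ _ (fun q =>
  'd (f \o chart_inv (chart_at p)) (chart_map (chart_at p) q)
     (tangent_coord p q (Y q)))).
  near=> q; rewrite -dvec_chart//; near: q.
    by apply: near_chart_dom; exact: mem_chart_at.
  exact: near_smooth_fun_at_differentiable.
have := smooth_at_diff_fun sf sY; apply: near_eq_smooth_at.
by apply: filterS (near_chart_invK (mem_chart_at p)) => x /= ->.
Unshelve. all: by end_near. Qed.

End SmoothMap.
(** * Sections along a map *)

Section Along.
Context {R : realType} {m n : nat} {M : manifold R m} {N : manifold R n}.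
Variable F : M -> N.
Implicit Types (p q : M) (W : M -> 'rV[R]_n).

Lemma near_eq_smooth_along W1 W2 p : (\forall q \near p, W1 q = W2 q) ->
  smooth_along F W1 p -> smooth_along F W2 p.
Proof.
by move=> W12; apply: near_eq_smooth_fun_at; apply: filterS W12 => q ->.
Qed.

Lemma smooth_along0 p : smooth_along F (fun=> 0) p.
Proof.
rewrite /smooth_along (_ : (fun q => _) = fun=> 0); first exact: smooth_fun_at_cst.
by apply/funext => q; rewrite /tangent_coord linear0.
Qed.

Lemma smooth_alongD W1 W2 p : smooth_along F W1 p -> smooth_along F W2 p ->
  smooth_along F (fun q => W1 q + W2 q) p.
Proof.
move=> s1 s2; have := smooth_fun_atD s1 s2; congr smooth_fun_at.
by apply/funext => q; rewrite /tangent_coord linearD.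
Qed.

Lemma smooth_alongZ (f : M -> R) W p :
  smooth_fun_at f p -> smooth_along F W p ->
  smooth_along F (fun q => f q *: W q) p.
Proof.
move=> sf /smooth_fun_at_rVP sW; apply/smooth_fun_at_rVP => i.
have := smooth_fun_atM sf (sW i); congr smooth_fun_at.
by apply/funext => q; rewrite /tangent_coord linearZ mxE.
Qed.

Lemma smooth_alongB W1 W2 p : smooth_along F W1 p -> smooth_along F W2 p ->
  smooth_along F (fun q => W1 q - W2 q) p.
Proof.
move=> s1 s2; rewrite (_ : (fun q => _) = (fun q => W1 q + -1 *: W2 q)).
  by apply: smooth_alongD s1 _; apply: smooth_alongZ s2; exact: smooth_fun_at_cst.
by apply/funext => q; rewrite scaleN1r.
Qed.

Lemma smooth_along_coord W p i : smooth_along F W p ->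
  smooth_fun_at (fun q => tangent_coord (F p) (F q) (W q) 0 i : R) p.
Proof. by move=> /smooth_fun_at_rVP. Qed.

Hypothesis cF : continuous F.

Lemma near_map_chart p : \forall q \near p, chart_dom (chart_at (F p)) (F q).
Proof. exact/cF/near_chart_dom/mem_chart_at. Qed.

Lemma smooth_along_frame w p : smooth_along F (fun q => frame (F p) (F q) w) p.
Proof.
apply: near_eq_smooth_fun_at (smooth_fun_at_cst w p).
by apply: filterS (near_map_chart p) => q Fq; rewrite frameK.
Qed.

Lemma near_frame_sum W p : \forall q \near p,
  W q = \sum_i tangent_coord (F p) (F q) (W q) 0 i *:
          frame (F p) (F q) (delta_mx 0 i).
Proof.
by apply: filterS (near_map_chart p) => q Fq; rewrite -frame_sum tangent_coordK.
Qed.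

End Along.

Lemma smooth_field_frame (R : realType) (m : nat) (M : manifold R m) w (p : M) :
  smooth_field_at (fun q => frame p q w) p.
Proof. by apply: (@smooth_along_frame _ _ _ _ _ idfun) => ?. Qed.

(** * Metrics *)

Section Metric.
Context {R : realType} {m : nat} {M : manifold R m} (g : metric M).
Implicit Types (p : M) (u v w : 'rV[R]_m).

Lemma mdotC p u v : mdot g p u v = mdot g p v u.
Proof. exact: gram_sym. Qed.

Lemma mdotDl p u v w : mdot g p (u + v) w = mdot g p u w + mdot g p v w.
Proof. by rewrite /mdot /inner !mulmxDl mxE. Qed.

Lemma mdotZl p (a : R) u w : mdot g p (a *: u) w = a * mdot g p u w.
Proof. by rewrite /mdot /inner -!scalemxAl mxE. Qed.

Lemma mdotDr p u v w : mdot g p w (u + v) = mdot g p w u + mdot g p w v.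
Proof. by rewrite mdotC mdotDl !(mdotC _ w). Qed.

Lemma mdotZr p (a : R) u w : mdot g p w (a *: u) = a * mdot g p w u.
Proof. by rewrite mdotC mdotZl (mdotC _ w). Qed.

Lemma mdot0l p u : mdot g p 0 u = 0.
Proof. by rewrite -(scale0r 0) mdotZl mul0r. Qed.

Lemma mdot0r p u : mdot g p u 0 = 0.
Proof. by rewrite mdotC mdot0l. Qed.

Lemma mdotBl p u v w : mdot g p (u - v) w = mdot g p u w - mdot g p v w.
Proof. by rewrite mdotDl -scaleN1r mdotZl mulN1r. Qed.

Lemma mdotBr p u v w : mdot g p w (u - v) = mdot g p w u - mdot g p w v.
Proof. by rewrite mdotC mdotBl !(mdotC _ w). Qed.

Lemma mdot_sumr p (I : finType) (u : I -> 'rV[R]_m) w :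
  mdot g p w (\sum_i u i) = \sum_i mdot g p w (u i).
Proof. by elim/big_rec2 : _ => [|i a b _ <-]; rewrite ?mdot0r ?mdotDr. Qed.

Lemma mdot_suml p (I : finType) (u : I -> 'rV[R]_m) w :
  mdot g p (\sum_i u i) w = \sum_i mdot g p (u i) w.
Proof. by rewrite mdotC mdot_sumr; apply: eq_bigr => i _; exact: mdotC. Qed.

Lemma mdot_eq0 p u : mdot g p u u = 0 -> u = 0.
Proof.
move=> u0; apply/eqP/negPn/negP => /(gram_pos g p).
by rewrite -/(mdot g p u u) u0 ltxx.
Qed.

Lemma mdot_nondeg p u : (forall v, mdot g p u v = 0) -> u = 0.
Proof. by move=> /(_ u) /mdot_eq0. Qed.

End Metric.

Lemma smooth_fun_at_det (R : realType) (m k : nat) (M : manifold R m)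
    (A : M -> 'M[R]_k) (p : M) :
  (forall i j, smooth_fun_at (fun q => A q i j : R) p) ->
  smooth_fun_at (fun q => \det (A q) : R) p.
Proof.
move=> sA; apply: smooth_fun_at_sum => s; apply: smooth_fun_atM.
  exact: smooth_fun_at_cst.
by apply: smooth_fun_at_prod => i; exact: sA.
Qed.

(** By Cramer's rule, an entry of the inverse is a cofactor over the determinant. *)
Lemma smooth_fun_at_invmx (R : realType) (m k : nat) (M : manifold R m)
    (A : M -> 'M[R]_k) (p : M) i j :
  (\forall q \near p, A q \in unitmx) ->
  (forall i j, smooth_fun_at (fun q => A q i j : R) p) ->
  smooth_fun_at (fun q => invmx (A q) i j : R) p.
Proof.
move=> Au sA.
apply: (@near_eq_smooth_fun_at _ _ _ _
  (fun q => (\det (A q))^-1 * cofactor (A q) j i)).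
  by apply: filterS Au => q Aq; rewrite /invmx Aq !mxE.
apply: smooth_fun_atM.
  apply: smooth_fun_atV; last exact: smooth_fun_at_det.
  by have := nbhs_singleton Au; rewrite unitmxE unitfE.
apply: smooth_fun_atM; first exact: smooth_fun_at_cst.
apply: smooth_fun_at_det => a b.
have := sA (lift j a) (lift i b); congr smooth_fun_at.
by apply/funext => q; rewrite !mxE.
Qed.

(** Raising an index preserves smoothness: in a local frame the components of
    [X] are those of the covector [mdot g _ (X _)] times the inverse of the Gram
    matrix. *)
Lemma smooth_field_at_dual (R : realType) (m : nat) (M : manifold R m)
    (g : metric M) (X : M -> 'rV[R]_m) (p : M) :
  (forall Y, smooth_field_at Y p ->
    smooth_fun_at (fun q => mdot g q (X q) (Y q) : R) p) ->
  smooth_field_at X p.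
Proof.
move=> sX; pose E i q := frame p q (delta_mx 0 i).
have sE i : smooth_field_at (E i) p by exact: smooth_field_frame.
pose G q : 'M[R]_m := \matrix_(i, j) mdot g q (E i q) (E j q).
pose xi q : 'rV[R]_m := \row_j mdot g q (X q) (E j q).
have pdom : \forall q \near p, chart_dom (chart_at p) q.
  exact: near_chart_dom (mem_chart_at p).
have GE q x : x *m G q = \row_j mdot g q (frame p q x) (E j q).
  apply/rowP => j; rewrite !mxE frame_sum mdot_suml.
  by apply: eq_bigr => i _; rewrite mxE mdotZl.
have Gunit : \forall q \near p, G q \in unitmx.
  apply: filterS pdom => q pq.
  rewrite -row_free_unit -kermx_eq0; apply/rowV0P => x /sub_kermxP.
  rewrite GE => /rowP xG0; rewrite -(frameK x pq).
  rewrite (_ : frame p q x = 0); first by rewrite /tangent_coord linear0.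
  apply: (@mdot_eq0 _ _ _ g q); rewrite {2}frame_sum mdot_sumr big1// => i _.
  by have := xG0 i; rewrite !mxE mdotZr => ->; rewrite mulr0.
have sG i j : smooth_fun_at (fun q => G q i j : R) p.
  by have := gram_smooth g (sE i) (sE j); congr smooth_fun_at;
    apply/funext => q; rewrite mxE.
apply/smooth_fun_at_rVP => i.
apply: (@near_eq_smooth_fun_at _ _ _ _
  (fun q => \sum_j xi q 0 j * invmx (G q) j i)).
  near=> q; have pq : chart_dom (chart_at p) q by near: q.
  have Gq : G q \in unitmx by near: q.
  have -> : xi q = tangent_coord p q (X q) *m G q.
    by rewrite GE tangent_coordK.
  transitivity ((tangent_coord p q (X q) *m G q *m invmx (G q)) 0 i).
    by rewrite [RHS]mxE.
  by rewrite mulmxK.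
apply: smooth_fun_at_sum => j; apply: smooth_fun_atM.
  have := sX _ (sE j); congr smooth_fun_at.
  by apply/funext => q; rewrite mxE.
exact: smooth_fun_at_invmx.
Unshelve. all: by end_near. Qed.

Lemma smooth_field_at_grad (R : realType) (m : nat) (M : manifold R m)
    (g : metric M) (f : M -> R) (p : M) :
  smooth_fun_at f p -> smooth_field_at (grad g f) p.
Proof.
move=> sf; apply: (@smooth_field_at_dual _ _ _ g) => Y sY.
have := smooth_fun_at_dfun sf sY; congr smooth_fun_at.
by apply/funext => q; rewrite mdot_grad.
Qed.

Lemma smooth_fun_at_mdot_along (R : realType) (m n : nat) (M : manifold R m)
    (N : manifold R n) (h : metric N) (F : M -> N) (W1 W2 : M -> 'rV[R]_n) p :
  smooth_map F -> smooth_along F W1 p -> smooth_along F W2 p ->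
  smooth_fun_at (fun q => mdot h (F q) (W1 q) (W2 q) : R) p.
Proof.
move=> smF s1 s2; pose E i y := frame (F p) y (delta_mx 0 i).
apply: (@near_eq_smooth_fun_at _ _ _ _ (fun q => \sum_i \sum_j
    tangent_coord (F p) (F q) (W1 q) 0 i *
    (tangent_coord (F p) (F q) (W2 q) 0 j * mdot h (F q) (E i (F q)) (E j (F q))))).
  near=> q.
  have e1 : W1 q = \sum_i tangent_coord (F p) (F q) (W1 q) 0 i *: E i (F q).
    by near: q; apply: near_frame_sum; case: smF.
  have e2 : W2 q = \sum_i tangent_coord (F p) (F q) (W2 q) 0 i *: E i (F q).
    by near: q; apply: near_frame_sum; case: smF.
  rewrite [in RHS]e1 mdot_suml; apply: eq_bigr => i _.
  rewrite mdotZl -mulr_sumr; congr (_ * _).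
  rewrite [in RHS]e2 mdot_sumr; apply: eq_bigr => j _.
  by rewrite mdotZr.
apply: smooth_fun_at_sum => i; apply: smooth_fun_at_sum => j.
apply: smooth_fun_atM; first exact: smooth_along_coord.
apply: smooth_fun_atM; first exact: smooth_along_coord.
apply: (@smooth_fun_at_comp _ _ _ _ _ _ smF (fun y => mdot h y (E i y) (E j y))).
by apply: gram_smooth; exact: smooth_field_frame.
Unshelve. all: by end_near. Qed.

(** * Connections along a map *)

Section Connection.
Context {R : realType} {m n : nat} {M : manifold R m} {N : manifold R n}.
Context {F : M -> N} {nabla : M -> 'rV[R]_m -> (M -> 'rV[R]_n) -> 'rV[R]_n}.
Hypothesis nablaP : connection_along F nabla.
Implicit Types (p q : M) (v : 'rV[R]_m) (W : M -> 'rV[R]_n).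

Lemma conn0 p v : nabla p v (fun=> 0) = 0.
Proof.
have := conn_add nablaP v (smooth_along0 F p) (smooth_along0 F p).
under [in X in nabla p v X = _]eq_fun do rewrite addr0.
by move=> /esym/eqP; rewrite -subr_eq0 addrK => /eqP.
Qed.

(** Leibniz' rule for the indicator function of a neighbourhood on which the
    sections agree; it is constant near [p], so its differential vanishes. *)
Lemma near_eq_conn p v W1 W2 : (\forall q \near p, W1 q = W2 q) ->
  smooth_along F W1 p -> nabla p v W1 = nabla p v W2.
Proof.
move=> W12 s1; have s2 := near_eq_smooth_along W12 s1.
pose f q : R := if `[< W1 q = W2 q >] then 1 else 0.
have f1 : \forall q \near p, 1 = f q.
  by apply: filterS W12 => q Wq; rewrite /f asboolT.
have c1 : smooth_fun_at (fun _ : M => 1 : R) p by exact: smooth_fun_at_cst.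
have sf : smooth_fun_at f p.
  exact: near_eq_smooth_fun_at f1 c1.
have fp : f p = 1 by rewrite -(nbhs_singleton f1).
have df : dfun f p v = 0.
  rewrite -(dfun_cst (1 : R) p v).
  exact: near_eq_dvec (smooth_fun_at_differentiable c1) f1.
have := conn_leibniz nablaP v sf s1; have := conn_leibniz nablaP v sf s2.
rewrite df fp !scale0r !add0r !scale1r => <- <-; congr (nabla p v).
apply/funext => q; rewrite /f; case: asboolP => [->//|_].
by rewrite !scale0r.
Qed.

Lemma conn_sum (I : finType) (W : I -> M -> 'rV[R]_n) p v :
  (forall i, smooth_along F (W i) p) ->
  nabla p v (fun q => \sum_i W i q) = \sum_i nabla p v (W i).
Proof.
move=> sW; rewrite (_ : (fun q => _) =
    \big[(fun f g q => f q + g q)/fun=> 0]_i W i); last first.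
  by apply/funext => y; elim/big_rec2 : _ => //= i a b _ ->.
suff [] : smooth_along F (\big[(fun f g q => f q + g q)/fun=> 0]_i W i) p /\
  nabla p v (\big[(fun f g q => f q + g q)/fun=> 0]_i W i) =
  \sum_i nabla p v (W i) by [].
elim/big_rec2 : _ => [|i a b _ [sb <-]].
  by split; [exact: smooth_along0|rewrite conn0].
split; first exact: smooth_alongD.
by rewrite (conn_add nablaP).
Qed.

Hypothesis cF : continuous F.

Lemma conn_frame W p v : smooth_along F W p ->
  nabla p v W = \sum_i
    (dfun (fun q => tangent_coord (F p) (F q) (W q) 0 i) p v *: delta_mx 0 i +
     W p 0 i *: nabla p v (fun q => frame (F p) (F q) (delta_mx 0 i))).
Proof.
move=> sW; rewrite (near_eq_conn _ (near_frame_sum cF W p) sW).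
have sE i := smooth_along_frame cF (delta_mx 0 i) p.
rewrite conn_sum => [|i]; last exact/smooth_alongZ/sE/smooth_along_coord.
apply: eq_bigr => i _; rewrite (conn_leibniz nablaP)//.
  by rewrite frame_self tangent_coord_self.
exact: smooth_along_coord.
Qed.

End Connection.
(** * The pullback connection *)

(** Coordinate fields commute: each of them applied to a coordinate function is
    constant, so both second derivatives in the torsion identity vanish. *)
Lemma frame_torsion_free (R : realType) (n : nat) (N : manifold R n)
    (h : metric N) nabla (a : N) (i j : 'I_n) :
  levi_civita h nabla ->
  nabla a (delta_mx 0 i) (fun y => frame a y (delta_mx 0 j)) =
  nabla a (delta_mx 0 j) (fun y => frame a y (delta_mx 0 i)).
Proof.
move=> lc; apply/eqP; rewrite -subr_eq0; apply/eqP; set z := (X in X = _).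
pose x k (y : N) : R := chart_map (chart_at a) y 0 k.
have sx0 : smooth_fun_at (chart_map (chart_at a)) a.
  exact: chart_compat (mem_chart_at a) (mem_chart_at a).
have sx k : smooth_fun_at (x k) a.
  by move/smooth_fun_at_rVP : sx0 => /(_ k).
have dx k b v : chart_dom (chart_at a) b ->
    dfun (x k) b v = tangent_coord a b v 0 k.
  move=> ab; have dab := chart_change_differentiable ab (mem_chart_at b).
  have dxk := differentiable_entry k dab.
  rewrite /tangent_coord -deriveE// derive_rV//.
  by rewrite deriveE.
have xE k l v : dfun (fun y => dfun (x k) y (frame a y (delta_mx 0 l))) a v = 0.
  pose d : R := (delta_mx 0 l : 'rV[R]_n) 0 k.
  have c1 : smooth_fun_at (fun _ : N => d) a by exact: smooth_fun_at_cst.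
  rewrite -(dfun_cst d a v).
  apply: near_eq_dvec (smooth_fun_at_differentiable c1) _.
  apply: filterS (near_chart_dom (mem_chart_at a)) => y ay.
  by rewrite dx// frameK.
apply/rowP => k; rewrite [RHS]mxE -[z](tangent_coord_self a) -dx; last first.
  exact: mem_chart_at.
have := lc_torsion_free lc (smooth_field_frame (delta_mx 0 i) a)
  (smooth_field_frame (delta_mx 0 j) a) (sx k).
by rewrite !frame_self !xE subr0.
Qed.

Section Pullback.
Context {R : realType} {m n : nat} {M : manifold R m} {N : manifold R n}.
Context {g : metric M} {h : metric N}.
Context {nablaM : M -> 'rV[R]_m -> (M -> 'rV[R]_m) -> 'rV[R]_m}.
Context {nablaN : N -> 'rV[R]_n -> (N -> 'rV[R]_n) -> 'rV[R]_n}.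
Context {F : M -> N} {nablaF : M -> 'rV[R]_m -> (M -> 'rV[R]_n) -> 'rV[R]_n}.
Hypothesis nablaM_lc : levi_civita g nablaM.
Hypothesis nablaN_lc : levi_civita h nablaN.
Hypothesis nablaF_pullback : pullback_connection F nablaN nablaF.
Hypothesis smF : smooth_map F.
Implicit Types (p : M).

Let cF : continuous F. Proof. by case: smF. Qed.
Let connF : connection_along F nablaF. Proof. by case: nablaF_pullback. Qed.
Let connN : connection_along (@idfun N) nablaN.
Proof. exact: lc_connection nablaN_lc. Qed.

Lemma nablaF_frame p v i :
  nablaF p v (fun q => frame (F p) (F q) (delta_mx 0 i)) =
  nablaN (F p) (dmap F p v) (fun y => frame (F p) y (delta_mx 0 i)).
Proof.
by case: nablaF_pullback => _ <-//; exact: smooth_field_frame.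
Qed.

Definition leibniz_metric_at p v (W1 W2 : M -> 'rV[R]_n) : Prop :=
  dfun (fun q => mdot h (F q) (W1 q) (W2 q)) p v =
  mdot h (F p) (nablaF p v W1) (W2 p) + mdot h (F p) (W1 p) (nablaF p v W2).

Lemma leibniz_metric_at_sym p v W1 W2 : leibniz_metric_at p v W1 W2 -> leibniz_metric_at p v W2 W1.
Proof.
rewrite /leibniz_metric_at => W12; under eq_fun do rewrite mdotC.
by rewrite W12 addrC; congr (_ + _); exact: mdotC.
Qed.

(** Both sides are compatible with linear combinations in [W2] whose coefficients
    are functions, so they only have to be compared on a local frame. *)
Lemma leibniz_metric_at_frame p v W1 W2 : smooth_along F W1 p -> smooth_along F W2 p ->
  (forall i, leibniz_metric_at p v W1 (fun q => frame (F p) (F q) (delta_mx 0 i))) ->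
  leibniz_metric_at p v W1 W2.
Proof.
move=> s1 s2 fr; pose w i q := tangent_coord (F p) (F q) (W2 q) 0 i.
pose E i q := frame (F p) (F q) (delta_mx 0 i).
have sE i : smooth_along F (E i) p by exact: smooth_along_frame.
have sw i : smooth_fun_at (w i) p by exact: smooth_along_coord.
have sh i : smooth_fun_at (fun q => mdot h (F q) (W1 q) (E i q) : R) p.
  exact: smooth_fun_at_mdot_along.
have swh i : smooth_fun_at (fun q => w i q * mdot h (F q) (W1 q) (E i q)) p.
  exact: smooth_fun_atM.
have eW : \forall q \near p, \sum_i w i q * mdot h (F q) (W1 q) (E i q) =
    mdot h (F q) (W1 q) (W2 q).
  apply: filterS (near_frame_sum cF W2 p) => q e2.
  by rewrite [in RHS]e2 mdot_sumr; apply: eq_bigr => i _; rewrite mdotZr.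
rewrite /leibniz_metric_at -[LHS]/(dvec _ p v).
rewrite (near_eq_dvec _ (smooth_fun_at_differentiable (smooth_fun_at_sum swh)) eW).
rewrite [LHS]dfun_sum// (conn_frame connF cF v s2) mdot_sumr.
rewrite [X in mdot h (F p) (nablaF p v W1) X](nbhs_singleton
  (near_frame_sum cF W2 p)) mdot_sumr -big_split.
apply: eq_bigr => i _ /=.
rewrite dfunM; [|exact: smooth_fun_at_differentiable..].
rewrite fr -/(E i) mdotDr !mdotZr -/(w i p) /w tangent_coord_self /E frame_self.
by rewrite mulrDr -addrA; congr (_ + _); rewrite addrC mulrC.
Qed.

Lemma nablaF_metric p v W1 W2 : smooth_along F W1 p -> smooth_along F W2 p ->
  leibniz_metric_at p v W1 W2.
Proof.
move=> s1 s2; have sE i := smooth_along_frame cF (delta_mx 0 i) p.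
apply: leibniz_metric_at_frame => // i; apply: leibniz_metric_at_sym.
apply: leibniz_metric_at_frame => // j; rewrite /leibniz_metric_at !nablaF_frame.
pose E i y := frame (F p) y (delta_mx 0 i).
have sEN k : smooth_field_at (E k) (F p) by exact: smooth_field_frame.
have := (dvec_comp smF (smooth_fun_at_differentiable
          (gram_smooth h (sEN i) (sEN j)))).2 v.
move=> e; apply: (etrans e); exact: (lc_metric nablaN_lc).
Qed.

(** Writing [F_* Y] in the coordinate frame of a chart around [F p], the
    components are the derivatives along [Y] of the components [f i] of [F]; so
    the second derivatives contribute [[X, Y] f i], and the Christoffel terms are
    symmetric because the connection on the target is torsion-free. *)
Lemma nablaF_torsion_free p X Y :
  smooth_field_at X p -> smooth_field_at Y p ->
  nablaF p (X p) (fun q => dmap F q (Y q)) -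
    nablaF p (Y p) (fun q => dmap F q (X q)) =
  dmap F p (nablaM p (X p) Y - nablaM p (Y p) X).
Proof.
move=> sX sY; pose f i q : R := chart_map (chart_at (F p)) (F q) 0 i.
have sf0 : smooth_fun_at (chart_map (chart_at (F p)) \o F) p.
  by case: smF.
have sf i : smooth_fun_at (f i) p.
  by move/smooth_fun_at_rVP : sf0 => /(_ i).
have df i : \forall q \near p, forall v,
    dfun (f i) q v = tangent_coord (F p) (F q) (dmap F q v) 0 i.
  near=> q => v.
  have pq : chart_dom (chart_at p) q.
    by near: q; apply: near_chart_dom; exact: mem_chart_at.
  have Fq : chart_dom (chart_at (F p)) (F q) by near: q; exact: near_map_chart.
  have dF : differentiable
      ((chart_map (chart_at (F p)) \o F) \o chart_inv (chart_at p))
      (chart_map (chart_at p) q).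
    by near: q; exact: near_smooth_fun_at_differentiable.
  have dFq : differentiable_fun_at (chart_map (chart_at (F p)) \o F) q.
    by apply: (diff_chart_change pq _ dF).1; exact: mem_chart_at.
  have dc : differentiable_fun_at (chart_map (chart_at (F p))) (F q).
    by apply: chart_change_differentiable => //; exact: mem_chart_at.
  rewrite -[tangent_coord _ _ _]((dvec_comp smF dc).2 v).
  have dfq := differentiable_entry i dFq.
  rewrite /dvec -deriveE// derive_rV//.
  by rewrite deriveE.
have dfp i v : dfun (f i) p v = dmap F p v 0 i.
  by rewrite (nbhs_singleton (df i)) tangent_coord_self.
have D Z v i : smooth_field_at Z p ->
    dfun (fun q => tangent_coord (F p) (F q) (dmap F q (Z q)) 0 i) p v =
    dfun (fun q => dfun (f i) q (Z q)) p v.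
  move=> sZ; apply: near_eq_dvec.
    exact/smooth_fun_at_differentiable/smooth_fun_at_dfun.
  by apply: filterS (df i) => q ->.
pose E i y := frame (F p) y (delta_mx 0 i).
have Ch v i : nablaF p v (fun q => frame (F p) (F q) (delta_mx 0 i)) =
    \sum_j dmap F p v 0 j *: nablaN (F p) (delta_mx 0 j) (E i).
  rewrite nablaF_frame.
  pose L w := nablaN (F p) w (E i).
  have linL : linear L by apply: (conn_linear connN); exact: smooth_field_frame.
  pose HL := GRing.isLinear.Build _ _ _ _ L linL.
  pose Ll : {linear _ -> _} := HB.pack L HL.
  rewrite -[LHS]/(Ll (dmap F p v)) {1}(matrix_sum_delta (dmap F p v)) big_ord1.
  by rewrite linear_sum; apply: eq_bigr => j _; rewrite linearZ.
rewrite !(conn_frame connF cF); [|exact: smooth_along_dmap..].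
rewrite !big_split /= opprD addrACA -sumrB -[RHS]addr0; congr (_ + _).
  rewrite [RHS](matrix_sum_delta _) big_ord1; apply: eq_bigr => i _.
  by rewrite !D// -scalerBl -(lc_torsion_free nablaM_lc sX sY (sf i)) dfp.
apply/eqP; rewrite subr_eq0; apply/eqP.
under eq_bigr do rewrite Ch scaler_sumr.
rewrite exchange_big; apply: eq_bigr => i _; rewrite Ch scaler_sumr.
apply: eq_bigr => j _; rewrite !scalerA mulrC; congr (_ *: _).
exact: frame_torsion_free nablaN_lc.
Unshelve. all: by end_near. Qed.

End Pullback.

(** * Horizontally conformal submersions *)

Section Submersion.
Context {R : realType} {m n : nat} {M : manifold R m} {N : manifold R n}.
Context {g : metric M} {h : metric N} {F : M -> N} {lambda : M -> R}.
Hypothesis hcs : horizontally_conformal_submersion g h F lambda.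
Implicit Types (p q : M) (X Y Z : M -> 'rV[R]_m).

Let smF : smooth_map F. Proof. exact: hcs_smooth hcs. Qed.

Lemma dmapD p u v : dmap F p (u + v) = dmap F p u + dmap F p v.
Proof. exact: linearD. Qed.

Lemma dmapB p u v : dmap F p (u - v) = dmap F p u - dmap F p v.
Proof. exact: linearB. Qed.

Lemma dmapZ p a v : dmap F p (a *: v) = a *: dmap F p v.
Proof. exact: linearZ. Qed.

(** As for [grad], the index of the covector [h w (F_* _)] is raised by [g]. *)
Definition dmap_adjoint p (w : 'rV[R]_n) : 'rV[R]_m :=
  (\row_j mdot h (F p) w (dmap F p (delta_mx 0 j))) *m invmx (gram g p).

Lemma mdot_adjoint p w v :
  mdot g p (dmap_adjoint p w) v = mdot h (F p) w (dmap F p v).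
Proof.
rewrite {1}/mdot /inner /dmap_adjoint mulmxKV ?gram_unit// mxE.
rewrite {2}(matrix_sum_delta v) big_ord1 /dmap linear_sum mdot_sumr.
by apply: eq_bigr => j _; rewrite !mxE linearZ mdotZr mulrC.
Qed.

Lemma horizontal_adjoint p w : horizontal g F p (dmap_adjoint p w).
Proof. by move=> v Fv0; rewrite mdot_adjoint Fv0 mdot0r. Qed.

Lemma dmap_adjoint_eq0 p w : dmap F p (dmap_adjoint p w) = 0 -> w = 0.
Proof.
move=> Aw0; have w0 : dmap_adjoint p w = 0.
  by apply: (@mdot_eq0 _ _ _ g p); rewrite mdot_adjoint Aw0 mdot0r.
apply: (@mdot_nondeg _ _ _ h (F p)) => w'.
have [v <-] := hcs_submersion hcs p w'.
by rewrite -mdot_adjoint w0 mdot0l.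
Qed.

(** Write [A] for the self-adjoint endomorphism [F_* F^*]. Conformality on the
    horizontal vectors [F^* w] says that [A] squares to [lambda^2 A], and
    surjectivity of [F_*] makes [A] injective. *)
Lemma dmap_adjointK p w :
  dmap F p (dmap_adjoint p w) = lambda p ^+ 2 *: w.
Proof.
apply/eqP; rewrite -subr_eq0; apply/eqP; apply: (@dmap_adjoint_eq0 p).
apply: (@mdot_nondeg _ _ _ h (F p)) => w'.
rewrite mdotC -mdot_adjoint mdotC mdot_adjoint mdotBl mdotZl.
rewrite (hcs_conformal hcs); [|exact: horizontal_adjoint..].
by rewrite mdot_adjoint subrr.
Qed.

(** Dividing by the dilation replaces inverting [F_* F^*] ([dmap_adjointK]), so
    that the lift depends smoothly on the point as soon as [F^*] does. *)
Definition horizontal_lift p (w : 'rV[R]_n) : 'rV[R]_m :=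
  (lambda p ^+ 2)^-1 *: dmap_adjoint p w.

Lemma lambda2_neq0 p : lambda p ^+ 2 != 0.
Proof. by rewrite expf_neq0// gt_eqF// (hcs_dilation_pos hcs). Qed.

Lemma horizontal_liftP p w : horizontal g F p (horizontal_lift p w).
Proof. by move=> v Fv0; rewrite mdotZl horizontal_adjoint// mulr0. Qed.

Lemma horizontal_liftK p w : dmap F p (horizontal_lift p w) = w.
Proof.
by rewrite dmapZ dmap_adjointK scalerA mulVf ?scale1r// lambda2_neq0.
Qed.

Lemma smooth_horizontal_lift W p : smooth_along F W p ->
  smooth_field_at (fun q => horizontal_lift q (W q)) p.
Proof.
move=> sW; apply: (@smooth_alongZ _ _ _ _ _ idfun).
  apply: smooth_fun_atV; first exact: lambda2_neq0.
  by apply: smooth_fun_atM; exact: (hcs_dilation_smooth hcs).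
apply: (@smooth_field_at_dual _ _ _ g) => Y sY.
have := smooth_fun_at_mdot_along h smF sW (smooth_along_dmap smF sY).
by congr smooth_fun_at; apply/funext => q; rewrite mdot_adjoint.
Qed.

Definition hpart Y q : 'rV[R]_m := horizontal_lift q (dmap F q (Y q)).
Definition vpart Y q : 'rV[R]_m := Y q - hpart Y q.

Lemma hpart_horizontal Y p : horizontal g F p (hpart Y p).
Proof. exact: horizontal_liftP. Qed.

Lemma vpart_vertical Y p : vertical F p (vpart Y p).
Proof. by rewrite /vertical dmapB horizontal_liftK subrr. Qed.

Lemma hpartDvpart Y : Y = (fun q => hpart Y q + vpart Y q).
Proof. by apply/funext => q; rewrite addrC subrK. Qed.

Lemma smooth_hpart Y p : smooth_field_at Y p -> smooth_field_at (hpart Y) p.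
Proof. by move=> sY; exact/smooth_horizontal_lift/smooth_along_dmap. Qed.

Lemma smooth_vpart Y p : smooth_field_at Y p -> smooth_field_at (vpart Y) p.
Proof. by move=> sY; apply: smooth_alongB => //; exact: smooth_hpart. Qed.

Lemma mdot_hpart Z Y p : horizontal g F p (Z p) ->
  mdot g p (Z p) (hpart Y p) = mdot g p (Z p) (Y p).
Proof.
move=> hZ; rewrite [in RHS](hpartDvpart Y) mdotDr (hZ (vpart Y p)) ?addr0//.
exact: vpart_vertical.
Qed.

Lemma conformal_horizontal p u v : horizontal g F p u ->
  mdot h (F p) (dmap F p u) (dmap F p v) = lambda p ^+ 2 * mdot g p u v.
Proof.
move=> hu; rewrite -(@mdot_hpart (fun=> u) (fun=> v))//.
rewrite -(hcs_conformal hcs)//; last exact: hpart_horizontal.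
by rewrite horizontal_liftK.
Qed.

(** * The second fundamental form *)

Context {nablaM : M -> 'rV[R]_m -> (M -> 'rV[R]_m) -> 'rV[R]_m}.
Context {nablaN : N -> 'rV[R]_n -> (N -> 'rV[R]_n) -> 'rV[R]_n}.
Context {nablaF : M -> 'rV[R]_m -> (M -> 'rV[R]_n) -> 'rV[R]_n}.
Hypothesis nablaM_lc : levi_civita g nablaM.
Hypothesis nablaN_lc : levi_civita h nablaN.
Hypothesis nablaF_pullback : pullback_connection F nablaN nablaF.

Let connF : connection_along F nablaF. Proof. by case: nablaF_pullback. Qed.
Let connM : connection_along (@idfun M) nablaM.
Proof. exact: lc_connection nablaM_lc. Qed.

Local Notation B := (second_fundamental_form F nablaM nablaF).

Lemma sff_sym X Y p : smooth_field_at X p -> smooth_field_at Y p ->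
  B X Y p = B Y X p.
Proof.
move=> sX sY; apply/eqP; rewrite -subr_eq0 opprD addrACA -opprD -dmapB.
rewrite (nablaF_torsion_free nablaM_lc nablaN_lc nablaF_pullback smF sX sY).
by rewrite subrr.
Qed.

Lemma sffDr X Y1 Y2 p : smooth_field_at Y1 p -> smooth_field_at Y2 p ->
  B X (fun q => Y1 q + Y2 q) p = B X Y1 p + B X Y2 p.
Proof.
move=> s1 s2; rewrite /second_fundamental_form (conn_add connM)// dmapD.
under eq_fun do rewrite dmapD.
rewrite (conn_add connF (X p) (smooth_along_dmap smF s1) (smooth_along_dmap smF s2)).
by rewrite opprD addrACA.
Qed.

Lemma sffDl X1 X2 Y p :
  smooth_field_at X1 p -> smooth_field_at X2 p -> smooth_field_at Y p ->
  B (fun q => X1 q + X2 q) Y p = B X1 Y p + B X2 Y p.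
Proof.
move=> s1 s2 sY; rewrite sff_sym//; last exact: smooth_alongD.
by rewrite sffDr// sff_sym// (sff_sym sY).
Qed.

Lemma smooth_nablaM X Y p : smooth_field_at X p -> smooth_field_at Y p ->
  smooth_field_at (fun q => nablaM q (X q) Y) p.
Proof. exact: (conn_smooth connM). Qed.

Lemma smooth_sff X Y p : smooth_field_at X p -> smooth_field_at Y p ->
  smooth_along F (B X Y) p.
Proof.
move=> sX sY; apply: smooth_alongB.
  by apply: (conn_smooth connF) => //; exact: smooth_along_dmap.
by apply: smooth_along_dmap => //; exact: smooth_nablaM.
Qed.

Lemma sff_vertical X V p : (forall q, vertical F q (V q)) ->
  B X V p = - dmap F p (nablaM p (X p) V).
Proof.
move=> vV; rewrite /second_fundamental_form.
by under eq_fun do rewrite vV; rewrite (conn0 connF) add0r.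
Qed.

(** Differentiate [h (F_* Y) (F_* Z) = lambda^2 g Y Z] along [X]: the
    derivatives of [Y] and [Z] cancel because [nablaM] and [nablaF] are metric. *)
Lemma sff_horizontal X Y Z p : smooth_field_at Y p -> smooth_field_at Z p ->
  (forall q, horizontal g F q (Y q)) -> (forall q, horizontal g F q (Z q)) ->
  mdot h (F p) (B X Y p) (dmap F p (Z p)) +
    mdot h (F p) (dmap F p (Y p)) (B X Z p) =
  2 * lambda p * dfun lambda p (X p) * mdot g p (Y p) (Z p).
Proof.
move=> sY sZ hY hZ.
have sl := hcs_dilation_smooth hcs p.
have sl2 : smooth_fun_at (fun q => lambda q * lambda q) p by exact: smooth_fun_atM.
have dl := smooth_fun_at_differentiable sl.
have := nablaF_metric nablaN_lc nablaF_pullback smF (X p)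
  (smooth_along_dmap smF sY) (smooth_along_dmap smF sZ).
rewrite /leibniz_metric_at.
rewrite (_ : (fun q => _) =
    fun q => (lambda q * lambda q) * mdot g q (Y q) (Z q)); last first.
  by apply/funext => q; rewrite (hcs_conformal hcs).
rewrite dfunM; last 2 first.
- exact: smooth_fun_at_differentiable.
- exact/smooth_fun_at_differentiable/gram_smooth.
rewrite (lc_metric nablaM_lc)// dfunM// mulrDr -!expr2.
rewrite (mdotC _ _ _ (Z p)) -!conformal_horizontal// => e.
rewrite /second_fundamental_form mdotBl mdotBr addrACA -e.
rewrite (mdotC h _ (dmap F p (nablaM p (X p) Y))).
by rewrite -opprD addrAC subrr add0r mulrC mulrDl -!mulrA mulr_natl mulr2n.
Qed.

(** An expression symmetric in its first two arguments and skew in its last two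
    vanishes; here [h (B X Y) (F_* Z)], which is skew in [Y] and [Z] as soon as
    [lambda] is constant to first order along horizontal vectors. *)
Lemma sff_hh_eq0 X Y p : horizontally_homothetic g F lambda ->
  smooth_field X -> smooth_field Y ->
  (forall q, horizontal g F q (X q)) -> (forall q, horizontal g F q (Y q)) ->
  B X Y p = 0.
Proof.
move=> homo sX sY hX hY.
have dl q u : horizontal g F q u -> dfun lambda q u = 0.
  by move=> hu; rewrite -(mdot_grad g) mdotC hu.
(* The lift of [B X Y] turns the trilinear expression into its squared norm. *)
pose Z q := horizontal_lift q (B X Y q).
have hZ q : horizontal g F q (Z q) by exact: horizontal_liftP.
have sZ : smooth_field Z by move=> q; exact/smooth_horizontal_lift/smooth_sff.
pose T A C D := mdot h (F p) (B A C p) (dmap F p (D p)).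
have skew A C D : smooth_field A -> smooth_field C -> smooth_field D ->
    (forall q, horizontal g F q (A q)) -> (forall q, horizontal g F q (C q)) ->
    (forall q, horizontal g F q (D q)) -> T A C D = - T A D C.
  move=> sA sC sD hA hC hD; apply/eqP; rewrite -addr_eq0 /T.
  rewrite [X in _ + X]mdotC (sff_horizontal A (sC p) (sD p) hC hD).
  by rewrite dl// mulr0 mul0r.
have sym A C D : smooth_field A -> smooth_field C -> T A C D = T C A D.
  by move=> sA sC; rewrite /T sff_sym.
have TXYZ : T X Y Z = - T X Y Z.
  (* Alternating the two symmetries runs through the six orders of the three
     arguments and accumulates three changes of sign. *)
  rewrite {1}(skew X Y Z)// (sym X Z Y)// (skew Z X Y)// opprK.
  by rewrite (sym Z Y X)// (skew Y Z X)// (sym Y X Z).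
apply: (@mdot_eq0 _ _ _ h (F p)); rewrite -{2}(horizontal_liftK p (B X Y p)).
apply/eqP; rewrite -[_ == 0](mulrn_eq0 _ 2) mulr2n.
by rewrite {1}[mdot _ _ _ _]TXYZ addNr.
Qed.

(** With [V] vertical and [X] horizontal, [nablaM X V] is orthogonal to every
    horizontal field as the horizontal distribution is totally geodesic; testing
    against its own horizontal part shows that it is vertical. *)
Lemma sff_hv_eq0 X V p :
  totally_geodesic_horizontal_distribution g F nablaM ->
  smooth_field X -> smooth_field V ->
  (forall q, horizontal g F q (X q)) -> (forall q, vertical F q (V q)) ->
  B X V p = 0.
Proof.
move=> tgh sX sV hX vV; rewrite sff_vertical//.
pose D q := nablaM q (X q) V; pose Z := hpart D.
have sD : smooth_field D by move=> q; exact: smooth_nablaM.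
have sZ : smooth_field Z by move=> q; exact: smooth_hpart.
have hZ q : horizontal g F q (Z q) by exact: hpart_horizontal.
have ZD0 : mdot g p (Z p) (D p) = 0.
  have := lc_metric nablaM_lc (X p) (sV p) (sZ p).
  under eq_fun do rewrite mdotC hZ//.
  rewrite dfun_cst (mdotC _ _ (V p)) (tgh _ _ sX sZ hX hZ)// addr0.
  by rewrite mdotC => <-.
have Z0 : Z p = 0 by apply: (@mdot_eq0 _ _ _ g p); rewrite mdot_hpart.
by rewrite -[X in dmap F p X]/(D p) -(horizontal_liftK p (dmap F p (D p)))
  -[horizontal_lift _ _]/(Z p) Z0 /dmap linear0 oppr0.
Qed.

Lemma totally_geodesic_map_fibers : totally_geodesic_map F nablaM nablaF ->
  totally_geodesic_fibers F nablaM.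
Proof.
move=> tg U V sU sV vU vV p; apply/eqP; rewrite -oppr_eq0.
by rewrite -sff_vertical// tg.
Qed.

(** If [B] vanishes then so does the horizontal part of [nablaM X V] for
    vertical [V]; applied to the vertical part of [nablaM X Y] this makes that
    part orthogonal to itself. *)
Lemma totally_geodesic_map_horizontal : totally_geodesic_map F nablaM nablaF ->
  totally_geodesic_horizontal_distribution g F nablaM.
Proof.
move=> tg X Y sX sY hX hY p.
pose D q := nablaM q (X q) Y; pose V := vpart D.
have sD : smooth_field D by move=> q; exact: smooth_nablaM.
have sV : smooth_field V by move=> q; exact: smooth_vpart.
have vV q : vertical F q (V q) by exact: vpart_vertical.
have vXV : vertical F p (nablaM p (X p) V).
  by apply/eqP; rewrite -oppr_eq0 -sff_vertical// tg.
have DV0 : mdot g p (D p) (V p) = 0.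
  have := lc_metric nablaM_lc (X p) (sY p) (sV p).
  under eq_fun do rewrite hY//.
  by rewrite dfun_cst (hY p _ vXV) addr0 => <-.
have V0 : V p = 0.
  apply: (@mdot_eq0 _ _ _ g p); rewrite {1}/V /vpart mdotBl DV0.
  by rewrite hpart_horizontal// subrr.
rewrite -[nablaM _ _ _]/(D p) (hpartDvpart D) -/V V0 addr0.
exact: hpart_horizontal.
Qed.

(** Take all three arguments of [sff_horizontal] equal to the horizontal part of
    the gradient of [lambda]. *)
Lemma totally_geodesic_map_homothetic : totally_geodesic_map F nablaM nablaF ->
  horizontally_homothetic g F lambda.
Proof.
move=> tg p; pose G := grad g lambda; pose X := hpart G.
have sG : smooth_field G.
  by move=> q; exact/smooth_field_at_grad/(hcs_dilation_smooth hcs).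
have sX : smooth_field X by move=> q; exact: smooth_hpart.
have hX q : horizontal g F q (X q) by exact: hpart_horizontal.
have := sff_horizontal X (sX p) (sX p) hX hX.
rewrite !tg// mdot0l mdot0r addr0 -(mdot_grad g) mdotC -mdot_hpart// -/G -/X.
move=> /esym/eqP; rewrite -mulrA mulf_eq0 mulf_eq0 pnatr_eq0/=.
rewrite (gt_eqF (hcs_dilation_pos hcs p)) /= -expr2 expf_eq0 /= => /eqP X0.
have {}X0 : X p = 0 by exact: (@mdot_eq0 _ _ _ g p).
rewrite /vertical -(horizontal_liftK p (dmap F p (grad g lambda p))).
by rewrite -[horizontal_lift _ _]/(X p) X0 /dmap linear0.
Qed.

(** Bilinearity and symmetry reduce to pairs of horizontal or vertical fields. *)
Lemma conditions_totally_geodesic_map : totally_geodesic_fibers F nablaM ->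
  totally_geodesic_horizontal_distribution g F nablaM ->
  horizontally_homothetic g F lambda -> totally_geodesic_map F nablaM nablaF.
Proof.
move=> tgf tgh homo X Y sX sY p.
have shX : smooth_field (hpart X) by move=> q; exact: smooth_hpart.
have svX : smooth_field (vpart X) by move=> q; exact: smooth_vpart.
have shY : smooth_field (hpart Y) by move=> q; exact: smooth_hpart.
have svY : smooth_field (vpart Y) by move=> q; exact: smooth_vpart.
have hX q : horizontal g F q (hpart X q) by exact: hpart_horizontal.
have hY q : horizontal g F q (hpart Y q) by exact: hpart_horizontal.
have vX q : vertical F q (vpart X q) by exact: vpart_vertical.
have vY q : vertical F q (vpart Y q) by exact: vpart_vertical.
rewrite (hpartDvpart X) (hpartDvpart Y) (sffDr _ (shY p) (svY p)).
rewrite !(sffDl (shX p) (svX p))// (sff_hh_eq0 p homo shX shY hX hY).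
rewrite (sff_sym (svX p) (shY p)) (sff_hv_eq0 p tgh shY svX hY vX).
rewrite (sff_hv_eq0 p tgh shX svY hX vY) sff_vertical//.
by rewrite (tgf _ _ svX svY vX vY) oppr0 !addr0.
Qed.

End Submersion.

Theorem theorem3p5 (R : realType) (m n : nat)
    (M : manifold R m) (N : manifold R n) (g : metric M) (h : metric N)
    (nablaM : M -> 'rV[R]_m -> (M -> 'rV[R]_m) -> 'rV[R]_m)
    (nablaN : N -> 'rV[R]_n -> (N -> 'rV[R]_n) -> 'rV[R]_n)
    (F : M -> N) (lambda : M -> R)
    (nablaF : M -> 'rV[R]_m -> (M -> 'rV[R]_n) -> 'rV[R]_n)
    (nablaM_lc : levi_civita g nablaM)
    (nablaN_lc : levi_civita h nablaN)
    (nablaF_pullback : pullback_connection F nablaN nablaF)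
    (F_hcs : horizontally_conformal_submersion g h F lambda) :
  totally_geodesic_map F nablaM nablaF <->
  [/\ totally_geodesic_fibers F nablaM,
      totally_geodesic_horizontal_distribution g F nablaM
    & horizontally_homothetic g F lambda].
Proof.
split=> [tg|[tgf tgh homo]].
  split.
  - exact: (totally_geodesic_map_fibers nablaF_pullback tg).
  - exact: (totally_geodesic_map_horizontal F_hcs nablaM_lc nablaF_pullback tg).
  - exact: (totally_geodesic_map_homothetic F_hcs nablaM_lc nablaN_lc
             nablaF_pullback tg).
exact: (conditions_totally_geodesic_map F_hcs nablaM_lc nablaN_lc
         nablaF_pullback tgf tgh homo).
Qed.
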